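(* Let $\mathfrak s$ be a symmetry jet on the manifold $M$, let $\nabla^{\mathfrak s}$ denote the induced affine connection and $\mathcal D$ the associated distribution on $\mathcal B^{(1)}$. Through the $1$-jet extension map $\varphi\mapsto j^1\varphi$, affine (local) diffeomorphisms of $(M,\nabla^{\mathfrak s})$ correspond to (local) bisections of $\mathcal B^{(1)}$ that are leaves of $\mathcal D$.
   Context: All objects are smooth; $n=\dim M$. $\mathcal B^{(1)}$ is the Lie groupoid over $M$ of linear isomorphisms $\xi:T_xM\to T_yM$, with source $\alpha(\xi)=x$, target $\beta(\xi)=y$ and composition; $-I_x=-\mathrm{id}_{T_xM}$. A local bisection of $\mathcal B^{(1)}$ is a section $b:U\to\mathcal B^{(1)}$ of $\alpha$ over an open $U$ with $b^0:=\beta\circ b$ a diffeomorphism onto an open set (a bisection if $U=M$ and $b^0$ is a diffeomorphism of $M$); it is identified with its image. For a (local) diffeomorphism $\varphi$ of $M$, $j^1\varphi$ is the (local) bisection $x\mapsto\varphi_{*_x}$. A $(1,1)$-jet is the $1$-jet $j^1_xb$ of a local bisection of $\mathcal B^{(1)}$; $p(j^1_xb)=b(x)$, $p_*(j^1_xb)=(b^0)_{*_x}$; $\mathcal B^{(1,1)}_{sh}$ is the set of those with $p=p_*$. A symmetry jet is a smooth section $\mathfrak s:M\to\mathcal B^{(1,1)}_{sh}$, with $\mathfrak s(x)$ a jet at $x$ and $p(\mathfrak s(x))=-I_x$. With $(bY)_{b^0(x')}=b(x')Y_{x'}$, the induced connection is $(\nabla^{\mathfrak s}_XY)_x=\frac12[X,Y+s_xY]_x$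 where $\mathfrak s(x)=j^1_xs_x$. A (local) diffeomorphism $\varphi$ is affine if $\varphi_*(\nabla_XY)=\nabla_{\varphi_*X}\varphi_*Y$ for all vector fields $X,Y$. Each $\xi\in\mathcal B^{(1)}$ with $\alpha(\xi)=x$ has a unique extension $S(\xi)=j^1_xa\in\mathcal B^{(1,1)}_{sh}$ with $p(S(\xi))=\xi$ which is affine, i.e. $\xi(\nabla^{\mathfrak s}_{X_x}Y)=\nabla^{\mathfrak s}_{\xi X_x}(aY)$ for all $X_x,Y$. The distribution $\mathcal D$ on $\mathcal B^{(1)}$ is $\mathcal D_\xi=a_{*_x}(T_xM)\subset T_\xi\mathcal B^{(1)}$ for any local bisection $a$ with $j^1_xa=S(\xi)$; it has rank $n$. A leaf of $\mathcal D$ is an $n$-dimensional submanifold everywhere tangent to $\mathcal D$. *)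

(* Defs.v *)
From HB Require Import structures.
From mathcomp Require Import all_boot all_order all_algebra.
From mathcomp Require Import all_classical all_reals all_analysis.

Set Implicit Arguments.
Unset Strict Implicit.
Unset Printing Implicit Defensive.

Import Order.TTheory GRing.Theory Num.Theory.
Import numFieldNormedType.Exports.
Local Open Scope classical_set_scope.
Local Open Scope ring_scope.

Section smooth_fun.
Variables (R : realType) (E F : normedModType R).

(* [U] is meant to be open. In finite dimension this is the usual class C^k:
   all iterated directional derivatives up to order k exist and are
   continuous. *)
Fixpoint Ck (k : nat) (U : set E) (f : E -> F) : Prop :=
  if k is k'.+1 then
    (forall u, U u -> differentiable f u) /\
    (forall v, Ck k' U (fun u => 'd f u v))
  else forall u, U u -> {for u, continuous f}.

Definition smooth_fun (U : set E) (f : E -> F) : Prop := forall k, Ck k U f.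

End smooth_fun.

(* Functions defined on a subset are total functions together with their
   domain; the values outside the domain are irrelevant. *)
Record chart (R : realType) (E : normedModType R) (T : Type) := Chart {
  cdom : set T;
  cto : T -> E;
  cinv : E -> T;
  ctoK : forall x, cdom x -> cinv (cto x) = x;
  cimg_open : open (cto @` cdom) }.

Record charted (R : realType) (E : normedModType R) := Charted {
  csort :> Type;
  atlas : set (chart E csort);
  chart_at : csort -> chart E csort;
  chart_at_atlas : forall x, atlas (chart_at x);
  chart_at_dom : forall x, cdom (chart_at x) x }.

(* The topology of a charted space is the one induced by its atlas. *)
Section charted_topology.
Variables (R : realType) (E : normedModType R) (T : charted E).

Definition copen : set_system T :=
  [set O | forall c, atlas c -> open (cto c @` (O `&` cdom c))].

Lemma copenT : copen [set: T].
Proof. by move=> c _; rewrite setTI; exact: cimg_open. Qed.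

Lemma copenI : setI_closed copen.
Proof.
move=> A B oA oB c Hc; suff -> : cto c @` ((A `&` B) `&` cdom c) =
  (cto c @` (A `&` cdom c)) `&` (cto c @` (B `&` cdom c)).
  by apply: openI; [exact: oA|exact: oB].
apply/seteqP; split=> [_ [x [[Ax Bx] cx] <-]|u [[x [Ax cx] <-] [y [By cy]]]].
  by split; exists x.
move=> exy; exists x => //; split=> //; split=> //.
by rewrite -(ctoK cx) -exy (ctoK cy).
Qed.

Lemma copen_bigU (I : Type) (f : I -> set T) :
  (forall i, copen (f i)) -> copen (\bigcup_i f i).
Proof.
move=> of_ c Hc; rewrite setI_bigcupl image_bigcup.
by apply: bigcup_open => i _; exact: of_.
Qed.

HB.instance Definition _ := gen_eqMixin (csort T).
HB.instance Definition _ := gen_choiceMixin (csort T).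
HB.instance Definition _ :=
  isOpenTopological.Build (csort T) copenT copenI copen_bigU.

End charted_topology.

Definition smooth_atlas (R : realType) (E : normedModType R) (T : charted E) :=
  forall c d : chart E T, atlas c -> atlas d ->
    open (cto c @` (cdom c `&` cdom d)) /\
    smooth_fun (cto c @` (cdom c `&` cdom d)) (cto d \o cinv c).

Record manifold (R : realType) (n : nat) := Manifold {
  msort :> charted ('rV[R]_n : normedModType R);
  manifold_smooth : smooth_atlas msort;
  manifold_hausdorff : hausdorff_space msort;
  manifold_second_countable : @second_countable msort }.

(* The tangent space at [x] of a space modelled on [E] is [E] itself: a tangent
   vector is given by its coordinates in the preferred chart [chart_at x].
   Linear maps act on row vectors on the right: a matrix [A] maps the
   vector [v] to [v *m A]. *)

Section maps.
Variables (R : realType) (E E' : normedModType R).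

(* Coordinate change of tangent vectors at [x], from the preferred chart to the
   chart [c], and back. *)
Definition tan_to (T : charted E) (c : chart E T) (x : T) : E -> E :=
  'd (cto c \o cinv (chart_at x)) (cto (chart_at x) x).
Definition tan_from (T : charted E) (c : chart E T) (x : T) : E -> E :=
  'd (cto (chart_at x) \o cinv c) (cto c x).

Definition loc_expr (T : charted E) (T' : charted E') (f : T -> T') (x : T)
  : E -> E' := cto (chart_at (f x)) \o f \o cinv (chart_at x).

(* Smooth near each point in the preferred charts at the point and at its
   image. *)
Definition smooth_on (T : charted E) (T' : charted E') (U : set T)
    (f : T -> T') : Prop :=
  forall x, U x -> {for x, continuous f} /\
    exists O, [/\ open O, O (cto (chart_at x) x) & smooth_fun O (loc_expr f x)].

Definition mdiff (T : charted E) (T' : charted E') (f : T -> T') (x : T)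
  : E -> E' := 'd (loc_expr f x) (cto (chart_at x) x).

Definition psmooth_on (T : charted E') (V : set E) (f : E -> T) : Prop :=
  forall u, V u -> {for u, continuous f} /\
    exists O, [/\ open O, O u & smooth_fun O (cto (chart_at (f u)) \o f)].

Definition pdiff (T : charted E') (f : E -> T) (u : E) : E -> E' :=
  'd (cto (chart_at (f u)) \o f) u.

End maps.

Section submanifold.
Variables (R : realType) (n : nat) (E : normedModType R) (T : charted E).

Definition local_param (N W : set T) (V : set 'rV[R]_n)
    (f : 'rV[R]_n -> T) : Prop :=
  [/\ open W, open V, psmooth_on V f,
      forall u, V u -> injective (pdiff f u) &
      f @` V = N `&` W /\
      exists g : T -> 'rV[R]_n, {within N `&` W, continuous g} /\
                                forall u, V u -> g (f u) = u].

Definition submanifold (N : set T) : Prop :=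
  forall xi, N xi -> exists W V f, local_param N W V f /\ W xi.

Definition tangent_space (N : set T) (xi : T) : set E :=
  [set w | exists W V f u,
     [/\ local_param N W V f, V u, f u = xi & range (pdiff f u) w]].

End submanifold.

Section on_manifold.
Variables (R : realType) (n : nat) (M : manifold R n).

Definition tan_to_mx (c : chart _ M) (x : M) : 'M[R]_n :=
  'J (cto c \o cinv (chart_at x)) (cto (chart_at x) x).
Definition tan_from_mx (c : chart _ M) (x : M) : 'M[R]_n :=
  'J (cto (chart_at x) \o cinv c) (cto c x).
Definition mdiff_mx (f : M -> M) (x : M) : 'M[R]_n :=
  'J (loc_expr f x) (cto (chart_at x) x).

Definition local_diffeo (U : set M) (phi : M -> M) : Prop :=
  [/\ open U, open (phi @` U), smooth_on U phi &
      exists psi : M -> M, smooth_on (phi @` U) psi /\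
                           forall x, U x -> psi (phi x) = x].

Definition diffeo (phi : M -> M) : Prop :=
  local_diffeo setT phi /\ phi @` setT = setT.

Definition field_expr (c : chart _ M) (X : M -> 'rV[R]_n) (u : 'rV[R]_n)
  : 'rV[R]_n := X (cinv c u) *m tan_to_mx c (cinv c u).

Definition smooth_field (W : set M) (X : M -> 'rV[R]_n) : Prop :=
  forall x, W x -> exists O,
    [/\ open O, O (cto (chart_at x) x) &
        smooth_fun O (field_expr (chart_at x) X)].

Definition bracket (X Y : M -> 'rV[R]_n) (x : M) : 'rV[R]_n :=
  let u := cto (chart_at x) x in
  let X' := field_expr (chart_at x) X in
  let Y' := field_expr (chart_at x) Y in
  'd Y' u (X' u) - 'd X' u (Y' u).

(* The pushforward of [X], defined on [phi @` U], by [phi] injective on [U]. *)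
Definition pushforward (U : set M) (phi : M -> M) (X : M -> 'rV[R]_n) (y : M)
  : 'rV[R]_n :=
  let x := xget y [set x | U x /\ phi x = y] in X x *m mdiff_mx phi x.

Record lin_iso := LinIso {
  src : M;
  tgt : M;
  iso_mx : 'M[R]_n;
  iso_mxP : iso_mx \in unitmx }.

Lemma lin_iso_eq (a b : lin_iso) :
  src a = src b -> tgt a = tgt b -> iso_mx a = iso_mx b -> a = b.
Proof.
case: a b => [x y A Au] [x' y' A' Au'] /= <- <- eA.
by case: _ / eA Au' => Au'; rewrite (bool_irrelevance Au Au').
Qed.

Definition unit_or_1 (A : 'M[R]_n) : 'M[R]_n :=
  if A \in unitmx then A else 1%:M.

Lemma unit_or_1P A : unit_or_1 A \in unitmx.
Proof. by rewrite /unit_or_1; case: ifPn => // _; rewrite unitmx1. Qed.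

(* Meant for [A] invertible. *)
Definition mk_iso (x y : M) (A : 'M[R]_n) : lin_iso :=
  LinIso x y (unit_or_1P A).

Definition minus_id (x : M) : lin_iso := mk_iso x x (- 1%:M).

Lemma minus_id_mx x : iso_mx (minus_id x) = - 1%:M.
Proof.
rewrite /= /unit_or_1 ifT // -scaleN1r unitmxZ ?unitmx1 //.
by rewrite unitrN unitr1.
Qed.

Lemma cto_diff (c d : chart _ M) (x : M) : atlas c -> atlas d ->
  cdom c x -> cdom d x -> differentiable (cto d \o cinv c) (cto c x).
Proof.
move=> Hc Hd cx dx; have [_ /(_ 1%N) [+ _]] := manifold_smooth Hc Hd.
by apply; exists x.
Qed.

Lemma jacobian_charts (c d : chart _ M) (x : M) : atlas c -> atlas d ->
  cdom c x -> cdom d x ->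
  'J (cto d \o cinv c) (cto c x) *m 'J (cto c \o cinv d) (cto d x) = 1%:M.
Proof.
move=> Hc Hd cx dx; apply/row_matrixP => i; rewrite !rowE mulmx1 mulmxA.
rewrite /jacobian !mul_rV_lin1.
have dcd := cto_diff Hc Hd cx dx.
have ddc := cto_diff Hd Hc dx cx.
have e : (cto d \o cinv c) (cto c x) = cto d x by rewrite /= ctoK.
rewrite -e in ddc *.
have := diff_comp dcd ddc => /(congr1 (fun f => f (delta_mx 0 i))) /= <-.
have near_id : \forall u \near cto c x,
    ((cto c \o cinv d) \o (cto d \o cinv c)) u = idfun u.
  have [oO _] := manifold_smooth Hc Hd.
  have : nbhs (cto c x) (cto c @` (cdom c `&` cdom d)).
    by apply: open_nbhs_nbhs; split=> //; exists x.
  apply: filterS => _ [y [cy dy] <-] /=.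
  by rewrite (ctoK cy) (ctoK dy).
have dif : differentiable ((cto c \o cinv d) \o (cto d \o cinv c)) (cto c x).
  exact: differentiable_comp.
rewrite -[LHS](deriveE _ dif) (near_eq_derive _ near_id).
by rewrite derive_id.
Qed.

Lemma tan_to_fromK (c : chart _ M) x : atlas c -> cdom c x ->
  tan_to_mx c x *m tan_from_mx c x = 1%:M.
Proof.
move=> Hc cx; apply: jacobian_charts => //.
  exact: chart_at_atlas.
exact: chart_at_dom.
Qed.

Lemma tan_from_toK (c : chart _ M) x : atlas c -> cdom c x ->
  tan_from_mx c x *m tan_to_mx c x = 1%:M.
Proof. by move=> Hc cx; apply: mulmx1C; exact: tan_to_fromK. Qed.

Lemma tan_to_unit (c : chart _ M) x : atlas c -> cdom c x ->
  tan_to_mx c x \in unitmx.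
Proof. move=> Hc cx; exact: (proj1 (mulmx1_unit (tan_to_fromK Hc cx))). Qed.

Lemma tan_from_unit (c : chart _ M) x : atlas c -> cdom c x ->
  tan_from_mx c x \in unitmx.
Proof. move=> Hc cx; exact: (proj2 (mulmx1_unit (tan_to_fromK Hc cx))). Qed.

Lemma det_continuous : continuous (fun A : 'M[R]_n => \det A).
Proof.
have addc : continuous (fun z : R * R => z.1 + z.2) by exact: add_continuous.
have mulc : continuous (fun z : R * R => z.1 * z.2) by exact: mul_continuous.
move=> A; apply: (@cvg_big _ _ _ _ _ addc _ (nbhs A)) => t _.
apply: cvgM; first exact: cvg_cst.
by apply: (@cvg_big _ _ _ _ _ mulc _ (nbhs A)) => i _; exact: coord_continuous.
Qed.

Lemma open_setX (X Y : topologicalType) (A : set X) (B : set Y) :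
  open A -> open B -> open (A `*` B).
Proof.
move=> oA oB; have -> : A `*` B = (fst @^-1` A) `&` (snd @^-1` B) by [].
by apply: openI; apply: open_comp => // p _; [exact: cvg_fst|exact: cvg_snd].
Qed.

Lemma open_unitmx : open [set A : 'M[R]_n | A \in unitmx].
Proof.
have -> : [set A : 'M[R]_n | A \in unitmx] =
    (fun A : 'M[R]_n => \det A) @^-1` [set x | x != 0].
  by apply/seteqP; split=> A /=; rewrite unitmxE unitfE.
by apply: open_comp => [A _|]; [exact: det_continuous|exact: open_neq].
Qed.

(* A pair of charts of [M] around x and y gives coordinates on the isos from
   T_xM to T_yM: those of x, those of y, and the matrix of the iso in the
   coordinate bases of the two charts. *)
Definition B1_model : normedModType R :=
  ('rV[R]_n * 'rV[R]_n * 'M[R]_n)%type.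

Section B1_chart.
Variables (c d : chart _ M) (Hc : atlas c) (Hd : atlas d).

Definition B1_dom : set lin_iso := [set xi | cdom c (src xi) /\ cdom d (tgt xi)].
Definition B1_to (xi : lin_iso) : B1_model :=
  (cto c (src xi), cto d (tgt xi),
   tan_from_mx c (src xi) *m iso_mx xi *m tan_to_mx d (tgt xi)).
Definition B1_inv (w : B1_model) : lin_iso :=
  let x := cinv c w.1.1 in let y := cinv d w.1.2 in
  mk_iso x y (tan_to_mx c x *m w.2 *m tan_from_mx d y).

Lemma unitmx_mul3 (P A Q : 'M[R]_n) : P \in unitmx -> A \in unitmx ->
  Q \in unitmx -> P *m A *m Q \in unitmx.
Proof. by move=> Pu Au Qu; rewrite !unitmx_mul Pu Au Qu. Qed.

Lemma unit_or_1E (A : 'M[R]_n) : A \in unitmx -> unit_or_1 A = A.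
Proof. by rewrite /unit_or_1 => ->. Qed.

Lemma conj_mxK (P P' Q Q' A : 'M[R]_n) : P *m P' = 1%:M -> Q *m Q' = 1%:M ->
  P *m (P' *m A *m Q) *m Q' = A.
Proof. by move=> PK QK; rewrite -!mulmxA QK mulmx1 mulmxA PK mul1mx. Qed.

Lemma B1_toK xi : B1_dom xi -> B1_inv (B1_to xi) = xi.
Proof.
case: xi => x y A Au [/= cx dy]; rewrite /B1_inv /B1_to /=.
rewrite (ctoK cx) (ctoK dy); apply: lin_iso_eq; [by []|by []|].
rewrite /= (conj_mxK _ (tan_to_fromK Hc cx) (tan_to_fromK Hd dy)).
exact: unit_or_1E.
Qed.

Lemma B1_img : B1_to @` B1_dom =
  (cto c @` cdom c `*` cto d @` cdom d) `*` [set A | A \in unitmx].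
Proof.
apply/seteqP; split=> [_ [[x y A Au] [/= cx dy] <-]|[[u v] A]].
  split; first by split; [exists x|exists y].
  exact: unitmx_mul3 (tan_from_unit Hc cx) Au (tan_to_unit Hd dy).
move=> /= [[[x cx <-] [y dy <-]] Au].
exists (mk_iso x y (tan_to_mx c x *m A *m tan_from_mx d y)); first by split.
rewrite /B1_to /= unit_or_1E.
  by rewrite (conj_mxK _ (tan_from_toK Hc cx) (tan_from_toK Hd dy)).
exact: unitmx_mul3 (tan_to_unit Hc cx) Au (tan_from_unit Hd dy).
Qed.

Lemma B1_img_open : open (B1_to @` B1_dom).
Proof.
rewrite B1_img; apply: open_setX; last exact: open_unitmx.
by apply: open_setX; exact: cimg_open.
Qed.

Definition B1_chart : chart B1_model lin_iso := Chart B1_toK B1_img_open.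

End B1_chart.

Definition B1_atlas : set (chart B1_model lin_iso) :=
  [set C | exists c d (Hc : atlas c) (Hd : atlas d), C = B1_chart Hc Hd].

Definition B1_chart_at (xi : lin_iso) : chart B1_model lin_iso :=
  B1_chart (chart_at_atlas (src xi)) (chart_at_atlas (tgt xi)).

Lemma B1_chart_at_atlas xi : B1_atlas (B1_chart_at xi).
Proof. by do 4 eexists. Qed.

Lemma B1_chart_at_dom xi : cdom (B1_chart_at xi) xi.
Proof. by split; exact: chart_at_dom. Qed.

Definition B1 : charted B1_model :=
  Charted B1_chart_at_atlas B1_chart_at_dom.

Definition local_bisection (U : set M) (b : M -> B1) : Prop :=
  [/\ open U, smooth_on U b, forall x, U x -> src (b x) = x &
      local_diffeo U (fun x => tgt (b x))].

Definition bisection (b : M -> B1) : Prop :=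
  local_bisection setT b /\ diffeo (fun x => tgt (b x)).

Definition j1 (phi : M -> M) (x : M) : B1 := mk_iso x (phi x) (mdiff_mx phi x).

(* The field bY, defined on the image of [U] by b^0. *)
Definition bis_act (U : set M) (b : M -> B1) (Y : M -> 'rV[R]_n) (y : M)
  : 'rV[R]_n :=
  let x := xget y [set x | U x /\ tgt (b x) = y] in Y x *m iso_mx (b x).

(* The 1-jet at x of a local bisection is encoded by its value and its
   differential at x; only the elements that satisfy [jet_rep] for some local
   bisection are (1,1)-jets. *)
Definition jet : Type := (B1 * ('rV[R]_n -> B1_model))%type.

Definition jet_src (j : jet) : M := src j.1.

Definition jet_rep (j : jet) (U : set M) (b : M -> B1) : Prop :=
  [/\ local_bisection U b, U (jet_src j) &
      j = (b (jet_src j), mdiff b (jet_src j))].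

(* p = p_* : the value of b at x is the differential of b^0 at x. *)
Definition B11_sh : set jet :=
  [set j | exists U b, jet_rep j U b /\
     iso_mx (b (jet_src j)) = mdiff_mx (fun x => tgt (b x)) (jet_src j)].

(* Smoothness of a section of (1,1)-jets: the values depend smoothly on the
   point, and so do the differentials, read in fixed charts. *)
Definition smooth_jets (s : M -> jet) : Prop :=
  smooth_on setT (fun x => (s x).1) /\
  forall x0, exists O, [/\ open O, O (cto (chart_at x0) x0) &
    forall w, smooth_fun O (fun u =>
      let x := cinv (chart_at x0) u in
      tan_to (chart_at (s x0).1) (s x).1
        ((s x).2 (tan_from (chart_at x0) x w)))].

Record symmetry_jet := SymmetryJet {
  sjet :> M -> jet;
  sjet_sh : forall x, B11_sh (sjet x);
  sjet_minus_id : forall x, (sjet x).1 = minus_id x;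
  sjet_smooth : smooth_jets sjet }.

Section distribution.
Variable s : symmetry_jet.

Lemma sjet_rep_ex x : exists Ub : set M * (M -> B1), jet_rep (s x) Ub.1 Ub.2.
Proof. by have [U [b [sb _]]] := sjet_sh s x; exists (U, b). Qed.

(* A local bisection s_x with s(x) = j^1_x s_x. *)
Definition sjet_rep (x : M) : set M * (M -> B1) := projT1 (cid (sjet_rep_ex x)).

(* The value does not depend on the choice of [sjet_rep x]: the bracket at x
   involves only the 1-jet of s_x. *)
Definition conn (X Y : M -> 'rV[R]_n) (x : M) : 'rV[R]_n :=
  2^-1 *: bracket X
    (fun y => Y y + bis_act (sjet_rep x).1 (sjet_rep x).2 Y y) x.

(* Vector fields are allowed to be only locally defined; as the connection is a
   local operator, this is the same as testing on fields defined on [U]. *)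
Definition affine_on (U : set M) (phi : M -> M) : Prop :=
  forall (W : set M) (X Y : M -> 'rV[R]_n), open W -> W `<=` U ->
    smooth_field W X -> smooth_field W Y ->
    forall x, W x -> conn X Y x *m mdiff_mx phi x =
      conn (pushforward W phi X) (pushforward W phi Y) (phi x).

(* The fields [X] and [X'] extend the vectors X_x and xi X_x. *)
Definition affine_at (U : set M) (a : M -> B1) (x : M) : Prop :=
  forall (W W' : set M) (X X' Y : M -> 'rV[R]_n),
    open W -> W x -> W `<=` U -> open W' -> W' (tgt (a x)) ->
    smooth_field W X -> smooth_field W Y -> smooth_field W' X' ->
    X' (tgt (a x)) = X x *m iso_mx (a x) ->
    conn X Y x *m iso_mx (a x) = conn X' (bis_act W a Y) (tgt (a x)).

(* [j] is the affine extension S(xi) of [xi]. *)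
Definition affine_extension (xi : B1) (j : jet) : Prop :=
  [/\ B11_sh j, j.1 = xi &
      exists U a, jet_rep j U a /\ affine_at U a (src xi)].

(* The union over the extensions of [xi]; there is exactly one. *)
Definition distr (xi : B1) : set B1_model :=
  [set w | exists j U a, [/\ affine_extension xi j, jet_rep j U a &
                             range (mdiff a (src xi)) w]].

Definition leaf (N : set B1) : Prop :=
  submanifold n N /\ forall xi, N xi -> tangent_space n N xi = distr xi.

End distribution.

End on_manifold.

(* [f] induces a bijection from P to Q, the elements of P and of Q being
   considered as functions on [U] only. *)
Definition bij_on_dom (T T1 T2 : Type) (U : set T) (P : set (T -> T1))
    (Q : set (T -> T2)) (f : (T -> T1) -> (T -> T2)) : Prop :=
  [/\ forall g, P g -> Q (f g),
      forall g g', P g -> P g' ->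
        (forall x, U x -> f g x = f g' x) -> forall x, U x -> g x = g' x &
      forall h, Q h -> exists2 g, P g & forall x, U x -> f g x = h x].

(* Main.v *)
Require Import Defs.
From HB Require Import structures.
From mathcomp Require Import all_boot all_order all_algebra.
From mathcomp Require Import all_classical all_reals all_analysis.
Set Implicit Arguments.
Unset Strict Implicit.
Unset Printing Implicit Defensive.
Import Order.TTheory GRing.Theory Num.Theory.
Import numFieldNormedType.Exports.
Local Open Scope classical_set_scope.
Local Open Scope ring_scope.

(** Vectors are rows and matrices act on the right. In the preferred charts at
    x and at y = phi x, a local bisection b with base map phi becomes a matrix
    A(x'), the isomorphism b(x') read in these two fixed charts, and its
    differential at x is v |-> (v, v Dphi, DA(v)) ([mdiff_bisection]).

    The jet s(x) is semi-holonomic over - id. Differentiating the relation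
    (bY)(phi x') = Y(x') A(x') for b = s_x turns the bracket that defines the
    connection into

      nabla_X Y = DY(X) + Gamma_x(X, Y),  Gamma_x(v, w) = - (1/2) w Ds_x(v),

    a formula that involves only the jet s(x) ([conn_formula]). The same
    relation for an arbitrary b with Dphi = A(x) at x shows that the terms in
    DY cancel in nabla_X Y . A = nabla_{XA} (bY) ([act_diff], [conn_act_eq]).
    What remains is an algebraic condition on DA, with A = A(x):

      w DA(v) + Gamma_y(v A, w A) = Gamma_x(v, w) A   for all v, w.

    This is [preserves_christoffel]. Testing on fields that are constant in a
    chart shows that it is equivalent to affinity: a semi-holonomic jet is
    affine iff it satisfies the condition ([affine_at_compat]), and a local
    diffeomorphism phi is affine iff j1 phi satisfies it at every point
    ([affine_on_compat]). The condition determines DA(v) from A, hence an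
    affine extension of a given isomorphism is unique
    ([preserves_christoffel_unique], [affine_extension_jet]).

    The tangent space of the image of a bisection b at b(x) is the range of its
    differential ([bisection_tangent_space]). If phi is affine, the jet of j1
    phi at x is an affine extension of j1 phi x, therefore its range is the
    distribution and the image is a leaf. Conversely, if the image of b is a
    leaf, each vector (v, v Dphi, DA(v)) is tangent to an affine extension of
    b(x), so it equals (v, v A, L(v)) with L subject to the condition above.
    The second components say that b = j1 phi, the third ones that phi is
    affine. *)

(** * Locality of the differential, and continuity for matrices *)

Section diff_local.
Variables (R : realType) (E F : normedModType R).

Lemma near_diff_expansion (f g : E -> F) (x : E) : {near x, f =1 g} ->
  differentiable f x -> g \o shift x = cst (g x) + 'd f x +o_ 0 id.
Proof.
move=> fg df; apply/eqaddoP => e e0.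
have fg0 : \forall h \near (0 : E), f (h + x) = g (h + x).
  rewrite (near_shift x) /=; apply: filterS fg => y fgy.
  by rewrite /= sub0r addrNK.
have /eqaddoP/(_ e e0) := diff_locally df; apply: filterS2 fg0 => h fgh.
by rewrite !fctE /= fgh (nbhs_singleton fg).
Qed.

Lemma near_diff (f g : E -> F) (x : E) : {near x, f =1 g} ->
  differentiable f x -> 'd g x = 'd f x :> (E -> F).
Proof.
move=> fg df; apply: diff_unique; first exact: diff_continuous.
exact: near_diff_expansion.
Qed.

Lemma near_differentiable (f g : E -> F) (x : E) : {near x, f =1 g} ->
  differentiable f x -> differentiable g x.
Proof.
move=> fg df; apply/diff_locallyP; rewrite (near_diff fg df).
by split; [exact: diff_continuous|exact: near_diff_expansion].
Qed.

Lemma near_diffE (f g : E -> F) (x v : E) :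
  {near x, f =1 g} -> differentiable f x -> 'd g x v = 'd f x v.
Proof. by move=> fg df; rewrite (near_diff fg df). Qed.

Lemma diffDE (f g : E -> F) (u v : E) :
  differentiable f u -> differentiable g u ->
  'd (f + g) u v = 'd f u v + 'd g u v.
Proof. by move=> df dg; rewrite diffD. Qed.

End diff_local.

Lemma diff_compE (R : realType) (E F G : normedModType R) (f : E -> F)
    (g : F -> G) (x v : E) :
  differentiable f x -> differentiable g (f x) ->
  'd (g \o f) x v = 'd g (f x) ('d f x v).
Proof. by move=> df dg; rewrite diff_comp. Qed.

Lemma diff_idE (R : realType) (E : normedModType R) (u v : E) :
  'd (fun w : E => w) u v = v.
Proof. by have -> := @diff_val _ _ _ _ _ _ _ (is_diff_id u). Qed.

Lemma lie_bracket_at_zero (R : realType) (E : normedModType R) (F G : E -> E)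
    (u a : E) : F u = a -> G u = 0 -> 'd G u (F u) - 'd F u (G u) = 'd G u a.
Proof. by move=> -> ->; rewrite linear0 subr0. Qed.

Lemma half_double (R : realType) (V : lmodType R) (a g : V) :
  2^-1 *: (a + (a - g)) = a - 2^-1 *: g.
Proof.
rewrite addrA -mulr2n scalerBr -[a *+ 2]scaler_nat scalerA.
by rewrite mulVf ?scale1r// pnatr_eq0.
Qed.

Lemma addr_cancel_iff (V : zmodType) (p q g h : V) :
  p + h = p + q + g <-> q + g = h.
Proof. by rewrite -addrA; split=> [/addrI //|->]. Qed.

Lemma near_continuous (S T : topologicalType) (f g : S -> T) (x : S) :
  {near x, f =1 g} -> {for x, continuous f} -> {for x, continuous g}.
Proof.
move=> fg fc; rewrite /prop_for /continuous_at -(nbhs_singleton fg).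
by apply: cvg_trans fc; apply: near_eq_cvg.
Qed.

Lemma cvg_sumr (R : realType) (V : normedModType R) (T : Type)
    (F : set_system T) {FF : Filter F} (I : Type) (r : seq I) (P : pred I)
    (f : I -> T -> V) (a : I -> V) :
  (forall i, f i t @[t --> F] --> a i) ->
  \sum_(i <- r | P i) f i t @[t --> F] --> \sum_(i <- r | P i) a i.
Proof.
move=> fa; have addc : continuous (fun z : V * V => z.1 + z.2).
  exact: add_continuous.
by apply: (@cvg_big _ _ _ _ _ addc _ F) => i _; exact: fa.
Qed.

Section matrix_linear.
Variables (R : realType) (m n : nat).

(** Finite dimension: a linear map is a combination of coordinates. *)
Lemma linear_mx_continuous (V : normedModType R)
  (f : {linear 'M[R]_(m, n) -> V}) : continuous f.
Proof.
have -> : (f : _ -> V) =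
    (fun A => \sum_i \sum_j A i j *: f (delta_mx i j)).
  apply/funext => A; rewrite {1}[A]matrix_sum_delta linear_sum.
  apply: eq_bigr => i _; rewrite linear_sum.
  by apply: eq_bigr => j _; rewrite linearZ.
move=> A; apply: (cvg_sumr (F := nbhs A)) => i.
apply: (cvg_sumr (F := nbhs A)) => j.
by apply: cvgZr_tmp; exact: coord_continuous.
Qed.

Lemma mx_continuous (T : topologicalType) (f : T -> 'M[R]_(m, n)) (x : T) :
  (forall i j, {for x, continuous (fun t => f t i j)}) -> {for x, continuous f}.
Proof.
move=> fc; have -> : f = fun t => \sum_i \sum_j f t i j *: delta_mx i j.
  by apply/funext => t; exact: matrix_sum_delta.
apply: (cvg_sumr (F := nbhs x)) => i; apply: (cvg_sumr (F := nbhs x)) => j.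
by apply: cvgZr_tmp; exact: fc.
Qed.

End matrix_linear.

Lemma mulmx_continuous (R : realType) (m n p : nat) :
  continuous (fun q : 'M[R]_(m, n) * 'M[R]_(n, p) => q.1 *m q.2).
Proof.
move=> q; apply: mx_continuous => i j.
have -> : (fun t : 'M[R]_(m, n) * 'M[R]_(n, p) => (t.1 *m t.2) i j) =
    (fun t => \sum_k t.1 i k * t.2 k j) by apply/funext => t; rewrite mxE.
apply: (cvg_sumr (F := nbhs q)) => k; apply: cvgM.
  apply: (continuous_comp (g := fun A : 'M[R]_(m, n) => A i k)).
    exact: cvg_fst.
  exact: coord_continuous.
apply: (continuous_comp (g := fun A : 'M[R]_(n, p) => A k j)).
  exact: cvg_snd.
exact: coord_continuous.
Qed.

(** * Calculus of C^k maps *)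

Section scale_bilinear.
Variables (R : realType) (F : normedModType R).
Lemma scale_is_bilinear :
  bilinear_for
    (GRing.Scale.Law.clone _ _ *:%R _) (GRing.Scale.Law.clone _ _ *:%R _)
    (@GRing.scale R F).
Proof.
split=> [v|a] b x y /=; first by rewrite scalerDl scalerA.
by rewrite scalerDr !scalerA mulrC.
Qed.
HB.instance Definition _ :=
  bilinear_isBilinear.Build R R F F _ _ (@GRing.scale R F) scale_is_bilinear.
End scale_bilinear.

Section mxcoord.
Variables (R : realType) (m n : nat) (i : 'I_m) (j : 'I_n).
Definition mxcoord (A : 'M[R]_(m, n)) : R := A i j.
Lemma mxcoord_is_linear : linear mxcoord.
Proof. by move=> a A B; rewrite /mxcoord !mxE. Qed.
HB.instance Definition _ := GRing.isLinear.Build R 'M[R]_(m, n) R _ mxcoord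
  mxcoord_is_linear.
End mxcoord.

Section Ck_theory.
Variable (R : realType).
Implicit Types E F G H : normedModType R.

Lemma Ck_subset E F k (U V : set E) (f : E -> F) :
  V `<=` U -> Ck k U f -> Ck k V f.
Proof.
move=> VU; elim: k f => [|k IH] f /= => [fc u /VU/fc //|[df dfC]].
by split=> [u /VU/df //|v]; apply: IH.
Qed.

Lemma open_near E (U : set E) (P : E -> Prop) x : open U -> U x ->
  (forall u, U u -> P u) -> \forall u \near x, P u.
Proof. by move=> oU Ux UP; apply: filterS UP _; apply: open_nbhs_nbhs. Qed.

Lemma Ck_eq E F k (U : set E) (f g : E -> F) : open U ->
  (forall u, U u -> f u = g u) -> Ck k U f -> Ck k U g.
Proof.
move=> oU; elim: k f g => [|k IH] f g fg /=.
  move=> fc u Uu; apply: near_continuous (fc u Uu).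
  exact: open_near oU Uu _.
move=> [df dfC]; split=> [u Uu|v].
  by apply: near_differentiable (df u Uu); exact: open_near oU Uu _.
apply: IH (dfC v) => u Uu; rewrite (@near_diff _ _ _ f g)//; last exact: df.
exact: open_near oU Uu _.
Qed.

Lemma Ck_differentiable E F k (U : set E) (f : E -> F) u : Ck k.+1 U f -> U u ->
  differentiable f u.
Proof. by case=> df _ /df. Qed.

Lemma CkW E F k (U : set E) (f : E -> F) : Ck k.+1 U f -> Ck k U f.
Proof.
elim: k f => [|k IH] f [df dfC] /=.
  by move=> u Uu; exact/differentiable_continuous/df.
by split=> // v; apply: IH.
Qed.

Lemma Ck_cst E F k (U : set E) (a : F) : Ck k U (cst a).
Proof.
elim: k a => [|k IH] a /=; first by move=> u _; exact: cvg_cst.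
split=> // v; rewrite (_ : (fun u => _) = cst 0)//.
by apply/funext => u; rewrite diff_cst.
Qed.

Lemma Ck_lin E F G k (U : set E) (L : {linear F -> G}) (f : E -> F) :
  continuous L -> open U -> Ck k U f -> Ck k U (L \o f).
Proof.
move=> Lc oU; have dL w : differentiable L w by exact: linear_differentiable.
elim: k f => [|k IH] f /=.
  by move=> fc u Uu; apply: continuous_comp; [exact: fc|exact: Lc].
move=> [df dfC]; split=> [u Uu|v].
  by apply: differentiable_comp => //; exact: df.
apply: Ck_eq oU _ (IH _ (dfC v)) => u Uu /=.
by rewrite (diff_compE _ (df u Uu) (dL _)) diff_lin.
Qed.

Lemma Ck_add E F k (U : set E) (f g : E -> F) : open U ->
  Ck k U f -> Ck k U g -> Ck k U (f + g).
Proof.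
move=> oU; elim: k f g => [|k IH] f g /=.
  by move=> fc gc u Uu; apply: cvgD; [exact: fc|exact: gc].
move=> [df dfC] [dg dgC]; split=> [u Uu|v].
  by apply: differentiableD; [exact: df|exact: dg].
apply: Ck_eq oU _ (IH _ _ (dfC v) (dgC v)) => u Uu.
by rewrite diffD//; [exact: df|exact: dg].
Qed.

Lemma Ck_sum E F k (U : set E) (I : Type) (r : seq I) (f : I -> E -> F) :
  open U -> (forall i, Ck k U (f i)) ->
  Ck k U (fun u => \sum_(i <- r) f i u).
Proof.
move=> oU fC; elim: r => [|i r IH].
  apply: Ck_eq oU _ (@Ck_cst E F k U 0) => u _; by rewrite big_nil.
by apply: Ck_eq oU _ (Ck_add oU (fC i) IH) => u _; rewrite big_cons.
Qed.

Lemma Ck_bilin E F G H k (U : set E) (B : {bilinear F -> G -> H})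
    (f : E -> F) (g : E -> G) : continuous (fun q : F * G => B q.1 q.2) ->
  open U -> Ck k U f -> Ck k U g -> Ck k U (fun u => B (f u) (g u)).
Proof.
move=> Bc oU; elim: k f g => [|k IH] f g.
  move=> /= fc gc u Uu.
  apply: (@continuous_comp _ _ _ (fun u => (f u, g u)) (fun q => B q.1 q.2)).
    by apply: cvg_pair; [exact: fc|exact: gc].
  exact: Bc.
move=> fC gC; have [[df dfC] [dg dgC]] := (fC, gC).
have dfg u : U u -> differentiable (fun u => (f u, g u)) u.
  by move=> Uu; apply: differentiable_pair; [exact: df|exact: dg].
split=> [u Uu|v].
  apply: (@differentiable_comp _ _ _ _ (fun u => (f u, g u))
    (fun q => B q.1 q.2)); first exact: dfg.
  exact: differentiable_bilin.
apply: Ck_eq oU _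
  (Ck_add oU (IH _ _ (CkW fC) (dgC v)) (IH _ _ (dfC v) (CkW gC))) => u Uu.
have := @diff_comp _ _ _ _ (fun u => (f u, g u)) (fun q => B q.1 q.2) u
  (dfg u Uu) (differentiable_bilin _ Bc).
rewrite /comp /= => ->; rewrite diff_bilin//= diff_pair//.
  exact: df.
exact: dg.
Qed.

Lemma Ck_pair E F G k (U : set E) (f : E -> F) (g : E -> G) : open U ->
  Ck k U f -> Ck k U g -> Ck k U (fun u => (f u, g u)).
Proof.
move=> oU; elim: k f g => [|k IH] f g /=.
  by move=> fc gc u Uu; apply: cvg_pair; [exact: fc|exact: gc].
move=> [df dfC] [dg dgC]; split=> [u Uu|v].
  by apply: differentiable_pair; [exact: df|exact: dg].
apply: Ck_eq oU _ (IH _ _ (dfC v) (dgC v)) => u Uu.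
by rewrite diff_pair//; [exact: df|exact: dg].
Qed.

(** The chain rule contains 'd g (f u) ('d f u v), where both the base point
    and the direction depend on u. Expanding the direction in the canonical
    basis leaves products of coordinates of 'd f u v with the maps 'd g (f u)
    e_i, and the induction hypothesis applies to the latter; this is why the
    source of g has to be a space of row vectors. *)
Lemma Ck_comp E F m k (U : set E) (V : set 'rV[R]_m) (f : E -> 'rV[R]_m)
    (g : 'rV[R]_m -> F) : open U -> (forall u, U u -> V (f u)) ->
  Ck k U f -> Ck k V g -> Ck k U (g \o f).
Proof.
move=> oU UV; elim: k f g UV => [|k IH] f g UV.
  by move=> fc gc u Uu; apply: continuous_comp; [exact: fc|exact/gc/UV].
move=> fC gC; have [[df dfC] [dg dgC]] := (fC, gC).
split=> [u Uu|v].
  by apply: differentiable_comp; [exact: df|exact/dg/UV].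
have scc : continuous (fun q : R * F => q.1 *: q.2) by exact: scale_continuous.
apply: (Ck_eq oU _ (@Ck_sum _ _ _ _ _ (index_enum 'I_m)
  (fun i u => ('d f u v) 0 i *: 'd g (f u) (delta_mx 0 i)) oU _)) => [u Uu|i].
  rewrite (diff_compE _ (df u Uu) (dg _ (UV u Uu))).
  rewrite [in RHS](row_sum_delta ('d f u v)) linear_sum.
  by apply: eq_bigr => i _; rewrite linearZ.
apply: (@Ck_bilin _ _ _ _ _ _ (@GRing.scale R F)); [exact: scc|exact: oU|  |].
  have cc : continuous (mxcoord (0 : 'I_1) i : 'rV[R]_m -> R).
    exact: coord_continuous.
  exact: Ck_lin cc oU (dfC v).
apply: (IH f (fun w => 'd g w (delta_mx 0 i))) => //; first exact: CkW.
exact: dgC.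
Qed.
End Ck_theory.

Lemma mulmx_jacobian (R : realType) (m n : nat) (f : 'rV[R]_m -> 'rV[R]_n) u v :
  v *m 'J f u = 'd f u v.
Proof. exact: mul_rV_lin1. Qed.

Lemma mulmx_inj (R : realType) (m n : nat) (A B : 'M[R]_(m, n)) :
  (forall v : 'rV[R]_m, v *m A = v *m B) -> A = B.
Proof. by move=> AB; apply/row_matrixP => i; rewrite !rowE AB. Qed.

Lemma near_jacobian (R : realType) (m n : nat) (f g : 'rV[R]_m -> 'rV[R]_n) u :
  {near u, f =1 g} -> differentiable f u -> 'J g u = 'J f u.
Proof.
move=> fg df; apply: mulmx_inj => v.
rewrite [LHS]mulmx_jacobian [RHS]mulmx_jacobian.
exact: near_diffE.
Qed.

Lemma jacobian_comp (R : realType) (m n p : nat) (f : 'rV[R]_m -> 'rV[R]_n)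
    (g : 'rV[R]_n -> 'rV[R]_p) u :
  differentiable f u -> differentiable g (f u) ->
  'J (g \o f) u = 'J f u *m 'J g (f u).
Proof.
move=> df dg; apply: mulmx_inj => v.
by rewrite mulmxA !mulmx_jacobian diff_compE.
Qed.

Lemma jacobian_id (R : realType) (m : nat) (f : 'rV[R]_m -> 'rV[R]_m) u :
  (\forall u' \near u, f u' = u') -> differentiable f u /\ 'J f u = 1%:M.
Proof.
move=> fid; have idf : {near u, id =1 f} by apply: filterS fid.
split; first exact: near_differentiable idf _.
rewrite (near_jacobian idf)//; apply: mulmx_inj => v.
by rewrite mulmx_jacobian diff_val mulmx1.
Qed.

Section smooth_fun_theory.
Variable R : realType.
Implicit Types E F : normedModType R.

Lemma smooth_fun_differentiable E F (U : set E) (f : E -> F) u :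
  smooth_fun U f -> U u -> differentiable f u.
Proof. by move=> /(_ 1%N); exact: Ck_differentiable. Qed.

Lemma smooth_fun_diff E F (U : set E) (f : E -> F) v :
  smooth_fun U f -> smooth_fun U (fun u => 'd f u v).
Proof. by move=> fC k; have [_ /(_ v)] := fC k.+1. Qed.

(** The rows of the Jacobian are directional derivatives; the matrix is their
    sum after multiplication by the columns delta_mx i 0. *)
Lemma smooth_fun_jacobian m n (U : set 'rV[R]_m) (f : 'rV[R]_m -> 'rV[R]_n) :
  open U -> smooth_fun U f -> smooth_fun U (fun u => 'J f u).
Proof.
move=> oU fC k; apply: (Ck_eq oU _ (@Ck_sum _ _ _ _ _ _ (index_enum 'I_m)
  (fun i => mulmx (delta_mx i 0) \o (fun u => 'd f u (delta_mx 0 i))) oU _)).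
  move=> u Uu; apply/row_matrixP => l; rewrite [LHS]rowE [RHS]rowE.
  rewrite [RHS]mulmx_jacobian mulmx_sumr /=.
  rewrite (bigD1 l)//= big1 => [|i il].
    rewrite mulmxA mul_delta_mx addr0 (_ : delta_mx 0 0 = 1%:M) ?mul1mx//.
    by apply/matrixP => a b; rewrite !mxE !ord1.
  by rewrite mulmxA mul_delta_mx_0 ?mul0mx// eq_sym.
move=> i; apply: Ck_lin => //; first exact: linear_mx_continuous.
exact: smooth_fun_diff.
Qed.

End smooth_fun_theory.

(** * Topology and charts *)

Section charted_theory.
Variables (R : realType) (E : normedModType R) (T : charted E).

Lemma cto_open (c : chart E T) (O : set T) : atlas c -> open O ->
  open (cto c @` (O `&` cdom c)).
Proof. by move=> ac; apply. Qed.

Lemma open_charts (O : set T) :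
  (forall c, atlas c -> open (cto c @` (O `&` cdom c))) -> open O.
Proof. by []. Qed.

(** The open sets of a charted space are defined by the images of charts, so
    continuity of a map into it can be tested in any chart around the image
    point. Applied to both manifolds and spaces of isomorphisms. *)
Lemma chart_continuous (X : topologicalType) (f : X -> T) (x : X)
    (c : chart E T) : atlas c -> (\forall x' \near x, cdom c (f x')) ->
  {for x, continuous (cto c \o f)} -> {for x, continuous f}.
Proof.
move=> ac cf cfc A; rewrite {1}nbhsE => -[ O [oO Ofx] OA].
have cfx := nbhs_singleton cf.
have : nbhs (cto c (f x)) (cto c @` (O `&` cdom c)).
  by apply: open_nbhs_nbhs; split; [exact: cto_open|exists (f x)].
move=> /cfc; apply: filterS2 cf => x' cx' [t [Ot ct] ett].
by apply: OA; move: ett => /= ett; rewrite -(ctoK cx') -ett ctoK.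
Qed.

End charted_theory.

Section manifold_theory.
Variables (R : realType) (n : nat) (M : manifold R n).
Implicit Types (c d : chart 'rV[R]_n M).

Lemma chart_overlap_open c d : atlas c -> atlas d ->
  open (cto c @` (cdom c `&` cdom d)).
Proof. by move=> ac ad; have [] := manifold_smooth ac ad. Qed.

Lemma cdom_open c : atlas c -> open (cdom c : set M).
Proof.
move=> ac; apply: open_charts => d ad.
by rewrite setIC; exact: chart_overlap_open.
Qed.

Lemma cdom_near c (x : M) : atlas c -> cdom c x ->
  \forall x' \near x, cdom c x'.
Proof.
by move=> ac cx; apply: open_nbhs_nbhs; split => //; exact: cdom_open.
Qed.

Lemma transition_smooth c d : atlas c -> atlas d ->
  smooth_fun (cto c @` (cdom c `&` cdom d)) (cto d \o cinv c).
Proof. by move=> ac ad; have [] := manifold_smooth ac ad. Qed.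

Lemma cinv_continuous c x : atlas c -> cdom c x ->
  {for cto c x, continuous (cinv c)}.
Proof.
move=> ac cx.
have im : \forall u \near cto c x, (cto c @` cdom c) u.
  by apply: open_nbhs_nbhs; split; [exact: cimg_open|exists x].
apply: (chart_continuous ac).
  by apply: filterS im => _ [y cy <-]; rewrite ctoK.
apply/differentiable_continuous; apply: (proj1 (jacobian_id _)).
by apply: filterS im => _ [y cy <-]; rewrite /= ctoK.
Qed.

Lemma cto_continuous c (x : M) : atlas c -> cdom c x ->
  {for x, continuous (cto c)}.
Proof.
move=> ac cx A; rewrite {1}nbhsE => -[ O [oO Ofx] OA].
rewrite nbhsE; exists (cdom c `&` cto c @^-1` O); last by move=> y [_ /OA].
split=> //; apply: open_charts => d ad.
have -> : cto d @` ((cdom c `&` cto c @^-1` O) `&` cdom d) =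
   (cto d @` (cdom d `&` cdom c)) `&` (cto c \o cinv d) @^-1` O.
  apply/seteqP; split=> [_ [y [[cy Oy] dy] <-]|_ [[y [dy cy] <-]]].
    by split; [exists y|rewrite /= ctoK].
  by rewrite /= ctoK// => Oy; exists y.
rewrite openE => u [dcu Ou]; apply: filterI.
  by apply: open_nbhs_nbhs; split => //; exact: chart_overlap_open.
have := transition_smooth ad ac 0%N u dcu; apply.
exact: open_nbhs_nbhs.
Qed.

(** Transfers a property of the points near x to a neighbourhood of the
    coordinates of x; every comparison of coordinate expressions below goes
    through it, since cinv is only meaningful on the image of the chart. *)
Lemma near_cinv c x (P : M -> Prop) : atlas c -> cdom c x ->
  (\forall x' \near x, P x') ->
  \forall u \near cto c x, exists x', [/\ P x', cdom c x' & u = cto c x'].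
Proof.
move=> ac cx Px.
have im : \forall u \near cto c x, (cto c @` cdom c) u.
  by apply: open_nbhs_nbhs; split; [exact: cimg_open|exists x].
have := @cinv_continuous c x ac cx P; rewrite /= ctoK// => /(_ Px).
by apply: filterS2 im => _ [y cy <-]; rewrite /= ctoK// => Py; exists y.
Qed.

End manifold_theory.

Section smooth_at.
Variable R : realType.
Implicit Types E F G : normedModType R.

(** The germ version of smoothness, in the shape used by [smooth_on]. *)
Definition smooth_at E F (f : E -> F) (u : E) : Prop :=
  exists O, [/\ open O, O u & smooth_fun O f].

Lemma smooth_at_eq E F (f g : E -> F) u :
  {near u, f =1 g} -> smooth_at f u -> smooth_at g u.
Proof.
rewrite {1}/prop_near1 nbhsE => -[V [oV Vu] Vfg] [ O [oO Ou fO]].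
exists (V `&` O); split; [exact: openI|by []|move=> k].
apply: (@Ck_eq _ _ _ _ _ f) => [|v [/Vfg //]|]; first exact: openI.
by apply: Ck_subset (fO k) => v [].
Qed.

Lemma smooth_at_near_differentiable E F (f : E -> F) u : smooth_at f u ->
  \forall v \near u, differentiable f v.
Proof.
move=> [ O [oO Ou fO]]; apply: (open_near oO Ou) => v.
exact: smooth_fun_differentiable.
Qed.

Lemma smooth_at_differentiable E F (f : E -> F) u : smooth_at f u ->
  differentiable f u.
Proof. by move/smooth_at_near_differentiable/nbhs_singleton. Qed.

Lemma smooth_at_comp E m F (f : E -> 'rV[R]_m) (g : 'rV[R]_m -> F) u :
  smooth_at f u -> smooth_at g (f u) -> smooth_at (g \o f) u.
Proof.
move=> [ O [oO Ou fO]] [P [oP Pfu gP]].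
have [V [oV Vu] VP] : exists2 V, open_nbhs u V & V `<=` O `&` f @^-1` P.
  have : nbhs u (O `&` f @^-1` P).
    apply: filterI; first exact: open_nbhs_nbhs.
    have /differentiable_continuous := smooth_fun_differentiable fO Ou.
    by apply; exact: open_nbhs_nbhs.
  by rewrite nbhsE.
exists V; split=> // k; apply: (Ck_comp oV (V := P)) => [v /VP[]//||//].
by apply: Ck_subset (fO k) => v /VP[].
Qed.

Lemma smooth_at_pair E F G (f : E -> F) (g : E -> G) u :
  smooth_at f u -> smooth_at g u -> smooth_at (fun v => (f v, g v)) u.
Proof.
move=> [ O [oO Ou fO]] [P [oP Pu gP]].
have oOP := openI oO oP.
exists (O `&` P); split=> // k; apply: Ck_pair => //.
  by apply: Ck_subset (fO k) => v [].
by apply: Ck_subset (gP k) => v [].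
Qed.

Lemma smooth_at_diff E F (f : E -> F) u v :
  smooth_at f u -> smooth_at (fun u => 'd f u v) u.
Proof.
by move=> [ O [oO Ou fO]]; exists O; split => //; exact: smooth_fun_diff.
Qed.

Lemma smooth_at_jacobian m n (f : 'rV[R]_m -> 'rV[R]_n) u :
  smooth_at f u -> smooth_at (fun u => 'J f u) u.
Proof.
by move=> [ O [oO Ou fO]]; exists O; split => //; exact: smooth_fun_jacobian.
Qed.

Lemma smooth_at_id E (u : E) : smooth_at id u.
Proof.
exists setT; split; [exact: openT|by []|case=> [|k] /=].
  by move=> v _; exact: cvg_id.
split=> [v _ //|v].
rewrite (_ : (fun u => _) = cst v); first exact: Ck_cst.
by apply/funext => w; rewrite diff_val.
Qed.

End smooth_at.

Section manifold_charts.
Variables (R : realType) (n : nat) (M : manifold R n).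
Implicit Types (c d : chart 'rV[R]_n M).

Lemma transition_smooth_at c d x : atlas c -> atlas d -> cdom c x ->
  cdom d x -> smooth_at (cto d \o cinv c) (cto c x).
Proof.
move=> ac ad cx dx; exists (cto c @` (cdom c `&` cdom d)).
by split; [exact: chart_overlap_open|exists x|exact: transition_smooth].
Qed.

Lemma near_chart_id c x : atlas c -> cdom c x ->
  \forall u \near cto c x, (cto c \o cinv c) u = u.
Proof.
move=> ac cx; apply: filterS (near_cinv ac cx (filterT : nbhs x setT)).
by move=> _ [x' [_ cx' ->]] /=; rewrite ctoK.
Qed.

Lemma tan_to_mx_id (x : M) : tan_to_mx (chart_at x) x = 1%:M.
Proof.
apply: (proj2 (jacobian_id _)).
exact: near_chart_id (chart_at_atlas x) (chart_at_dom x).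
Qed.

Lemma tan_from_mx_id (x : M) : tan_from_mx (chart_at x) x = 1%:M.
Proof. exact: tan_to_mx_id. Qed.

Lemma src_continuous : continuous (@src R n M : B1 M -> M).
Proof.
apply/continuousP => O oO; apply: open_charts => _ [c [d [ac [ad ->]]]] /=.
have -> : B1_to c d @` (src (M := M) @^-1` O `&` B1_dom c d) =
    B1_to c d @` B1_dom c d `&`
    (fun w => w.1.1) @^-1` (cto c @` (O `&` cdom c)).
  apply/seteqP; split=> [_ [xi [Oxi dxi] <-]|_ [[xi dxi <-] [x [Ox cx]]] /=].
    split; [by exists xi|exists (src xi) => //].
    by split => //; exact: (proj1 dxi).
  move=> ex; exists xi => //; split=> //=.
  by rewrite -(ctoK (proj1 dxi)) -ex ctoK.
apply: openI; first exact: B1_img_open.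
apply: open_comp; last exact: cto_open.
by move=> w _; apply: continuous_comp; exact: cvg_fst.
Qed.

End manifold_charts.

(** * Local diffeomorphisms acting on vector fields *)

Section diff_mulmx.
Variables (R : realType) (E : normedModType R) (m n p : nat).
Variables (f : E -> 'M[R]_(m, n)) (g : E -> 'M[R]_(n, p)) (u : E).
Hypotheses (df : differentiable f u) (dg : differentiable g u).

Lemma differentiable_mulmx : differentiable (fun u => f u *m g u) u.
Proof.
apply: (@differentiable_comp _ _ _ _ (fun u => (f u, g u))
  (fun r => r.1 *m r.2)); first exact: differentiable_pair.
by apply: (differentiable_bilin (f := @mulmx R m n p)); exact: mulmx_continuous.
Qed.

Lemma diff_mulmx v :
  'd (fun u => f u *m g u) u v = f u *m 'd g u v + 'd f u v *m g u.
Proof.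
have db := @differentiable_bilin _ _ _ _ (@mulmx R m n p) (f u, g u)
  (@mulmx_continuous _ _ _ _).
apply: etrans (diff_compE v (differentiable_pair df dg) db) _.
rewrite (diff_bilin (f := @mulmx R m n p)); last exact: mulmx_continuous.
by rewrite diff_pair.
Qed.

End diff_mulmx.

Section local_diffeo_theory.
Variables (R : realType) (n : nat) (M : manifold R n).
Implicit Types (U W : set M) (phi psi : M -> M).

Lemma smooth_on_loc U phi x : smooth_on U phi -> U x ->
  smooth_at (loc_expr phi x) (cto (chart_at x) x).
Proof. by move=> sphi /sphi[]. Qed.

Lemma smooth_on_continuous U phi x : smooth_on U phi -> U x ->
  {for x, continuous phi}.
Proof. by move=> sphi /sphi[]. Qed.

Lemma near_chart_image U phi x : smooth_on U phi -> U x ->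
  \forall x' \near x, cdom (chart_at (phi x)) (phi x').
Proof.
move=> sphi Ux; apply: (smooth_on_continuous sphi Ux).
exact: cdom_near (chart_at_atlas _) (chart_at_dom _).
Qed.

(** The image of a smaller neighbourhood W of x still contains all points near
    phi x, by continuity of the inverse. *)
Lemma local_diffeo_near_image U phi psi W x :
  open (phi @` U) -> smooth_on (phi @` U) psi ->
  (forall x, U x -> psi (phi x) = x) -> open W -> U x -> W x ->
  \forall y \near phi x, W (psi y) /\ phi (psi y) = y.
Proof.
move=> oU spsi psiK oW Ux Wx.
have Uy : (phi @` U) (phi x) by exists x.
have im : \forall y \near phi x, (phi @` U) y by exact: open_nbhs_nbhs.
have : \forall y \near phi x, W (psi y).
  apply: (smooth_on_continuous spsi Uy); rewrite psiK//.
  exact: open_nbhs_nbhs.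
by apply: filterS2 im => _ [x' Ux' <-] Wx'; split=> //; rewrite psiK.
Qed.

(** In coordinates, the local inverse G undoes phi near x. The chart for the
    values of G is the preferred one at x rather than at psi (phi x), so that
    the composite with the expression of phi needs no transport along psi (phi
    x) = x. *)
Lemma local_diffeo_loc_inverse U phi x : local_diffeo U phi -> U x ->
  exists2 psi : M -> M,
    smooth_on (phi @` U) psi /\ (forall x, U x -> psi (phi x) = x) &
  let F := loc_expr phi x in
  let G := cto (chart_at x) \o psi \o cinv (chart_at (phi x)) in
  let u := cto (chart_at x) x in
  [/\ smooth_at G (cto (chart_at (phi x)) (phi x)),
      F u = cto (chart_at (phi x)) (phi x) &
      \forall u' \near u, G (F u') = u'].
Proof.
move=> [oU oV sphi [psi [spsi psiK]]] Ux; exists psi => //=.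
have Fu : loc_expr phi x (cto (chart_at x) x) =
    cto (chart_at (phi x)) (phi x).
  by rewrite /loc_expr /= ctoK//; exact: chart_at_dom.
split=> //.
  have Uy : (phi @` U) (phi x) by exists x.
  by have := smooth_on_loc spsi Uy; rewrite /loc_expr psiK.
have nU : \forall x' \near x, U x' /\ cdom (chart_at (phi x)) (phi x').
  by apply: filterI (near_chart_image sphi Ux); exact: open_nbhs_nbhs.
apply: filterS (near_cinv (chart_at_atlas x) (chart_at_dom x) nU).
move=> _ [x' [[Ux' dx'] cx' ->]].
by rewrite /loc_expr /= (ctoK cx') (ctoK dx') psiK.
Qed.

Lemma mdiff_mx_unit U phi x : local_diffeo U phi -> U x ->
  mdiff_mx phi x \in unitmx.
Proof.
move=> dphi Ux; have [_ _ sphi _] := dphi.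
have [psi _ /= [sG Fu GF]] := local_diffeo_loc_inverse dphi Ux.
have dF := smooth_at_differentiable (smooth_on_loc sphi Ux).
have dG := smooth_at_differentiable sG.
rewrite -Fu in dG.
have [_ J1] := jacobian_id GF.
have JFG := jacobian_comp dF dG.
exact: (proj1 (mulmx1_unit (etrans (esym JFG) J1))).
Qed.

End local_diffeo_theory.

Lemma mulmx_cancel (R : realType) (n : nat) (v : 'rV[R]_n)
    (T T' A S : 'M[R]_n) :
  T *m T' = 1%:M -> v *m T *m (T' *m A *m S) = v *m A *m S.
Proof. by move=> TT; rewrite !mulmxA -(mulmxA v) TT mulmx1. Qed.

Section action.
Variables (R : realType) (n : nat) (M : manifold R n).
Implicit Types (U W : set M) (phi psi : M -> M) (B : M -> 'M[R]_n).

(** Common form of [bis_act] (phi the base map, B the isomorphisms) and of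
    [pushforward] (B the differential of phi). *)
Definition act W phi B (Y : M -> 'rV[R]_n) (y : M) : 'rV[R]_n :=
  let x := xget y [set x | W x /\ phi x = y] in Y x *m B x.

(** The field B of isomorphisms T_x' M -> T_(phi x') M read in the two charts
    fixed at x and at phi x. *)
Definition iso_expr phi B x (u : 'rV[R]_n) : 'M[R]_n :=
  let x' := cinv (chart_at x) u in
  tan_from_mx (chart_at x) x' *m B x' *m tan_to_mx (chart_at (phi x)) (phi x').

Lemma act_eq U W phi B (Y : M -> 'rV[R]_n) x :
  local_diffeo U phi -> W `<=` U -> W x ->
  act W phi B Y (phi x) = Y x *m B x.
Proof.
move=> [_ _ _ [psi [_ psiK]]] WU Wx; rewrite /act /=.
rewrite (@xget_unique _ _ _ x)// => x' [Wx' exx'].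
by rewrite -[LHS]psiK ?exx' ?psiK//; exact: WU.
Qed.

Lemma field_expr_id (Y : M -> 'rV[R]_n) (x : M) :
  field_expr (chart_at x) Y (cto (chart_at x) x) = Y x.
Proof.
by rewrite /field_expr ctoK ?tan_to_mx_id ?mulmx1//; exact: chart_at_dom.
Qed.

Lemma iso_expr_id phi B x : iso_expr phi B x (cto (chart_at x) x) = B x.
Proof.
rewrite /iso_expr ctoK ?tan_to_mx_id ?tan_from_mx_id ?mulmx1 ?mul1mx//.
exact: chart_at_dom.
Qed.

(** The product rule for (BY)(phi x') = Y(x') B(x'). Near phi x the expression
    of the new field is P composed with the local inverse G of phi, where P is
    the product of the expressions of Y and B, and the chain rule along G is
    undone by evaluating at the vector v Dphi. *)
Lemma act_diff U W phi B (Y : M -> 'rV[R]_n) x :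
  local_diffeo U phi -> open W -> W `<=` U ->
  W x -> let u := cto (chart_at x) x in let y := phi x in
  let w := cto (chart_at y) y in
  let Y' := field_expr (chart_at x) Y in
  let Z' := field_expr (chart_at y) (act W phi B Y) in
  differentiable Y' u -> differentiable (iso_expr phi B x) u ->
  differentiable Z' w /\
  forall v, 'd Z' w (v *m mdiff_mx phi x) =
    'd Y' u v *m B x + Y x *m 'd (iso_expr phi B x) u v.
Proof.
move=> dphi oW WU Wx u y w Y' Z' dY dB.
have [oU oV sphi _] := dphi; have Ux := WU _ Wx.
have [psi [spsi psiK] /= [sG Fu GF]] := local_diffeo_loc_inverse dphi Ux.
set F := loc_expr phi x in Fu GF.
set G := _ \o _ in sG GF.
have dF : differentiable F u.
  exact: smooth_at_differentiable (smooth_on_loc sphi Ux).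
have dG : differentiable G (F u).
  by rewrite Fu; exact: smooth_at_differentiable sG.
have Gu : G (F u) = u by exact: (nbhs_singleton GF).
pose P := fun u' => Y' u' *m iso_expr phi B x u'.
have dP : differentiable P u by exact: differentiable_mulmx.
have PZ : {near w, P \o G =1 Z'}.
  have nW := local_diffeo_near_image oV spsi psiK oW Ux Wx.
  have nc : \forall y' \near y,
      (W (psi y') /\ phi (psi y') = y') /\ cdom (chart_at x) (psi y').
    apply: filterI => //.
    have Vy : (phi @` U) y by exists x.
    apply: (smooth_on_continuous spsi Vy); rewrite psiK//.
    exact: cdom_near (chart_at_atlas _) (chart_at_dom _).
  apply: filterS (near_cinv (chart_at_atlas y) (chart_at_dom y) nc).
  move=> _ [y' [[[Wy' ey'] cy'] dy' ->]].
  rewrite /P /G /Z' /Y' /field_expr /iso_expr /= (ctoK dy') (ctoK cy').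
  rewrite ey' -[in RHS]ey' (act_eq _ _ dphi WU Wy') ey'.
  by apply: mulmx_cancel; apply: tan_to_fromK => //; exact: chart_at_atlas.
have dPG : differentiable (P \o G) (F u).
  by apply: differentiable_comp; rewrite ?Gu.
rewrite /w -/y -Fu in PZ *; split; first exact: near_differentiable PZ _.
move=> v; apply: etrans (near_diffE _ PZ dPG) _.
rewrite mulmx_jacobian; apply: etrans (esym (diff_compE v dF dPG)) _.
have PGF : {near u, P =1 (P \o G) \o F}.
  by apply: filterS GF => u' GFu'; rewrite /= /G /= GFu'.
apply: etrans (near_diffE _ PGF dP) _.
apply: etrans (diff_mulmx dY dB v) _.
have -> : iso_expr phi B x u = B x by exact: iso_expr_id.
have -> : Y' u = Y x by exact: field_expr_id.
by rewrite addrC.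
Qed.

End action.

(** * The connection in coordinates *)

Section connection.
Variables (R : realType) (n : nat) (M : manifold R n).

Definition base_map (b : M -> B1 M) (x : M) : M := tgt (b x).
Definition iso_field (b : M -> B1 M) (x : M) : 'M[R]_n := iso_mx (b x).
Definition bis_expr (b : M -> B1 M) (x : M) : 'rV[R]_n -> 'M[R]_n :=
  iso_expr (base_map b) (iso_field b) x.

Lemma bis_actE U b Y : bis_act U b Y = act U (base_map b) (iso_field b) Y.
Proof. by []. Qed.

(** The first component of the expression of b is the identity, because b is a
    section of the source map; the second is the expression of the base map. *)
Lemma mdiff_bisection U b x : local_bisection U b -> U x ->
  let u := cto (chart_at x) x in
  differentiable (bis_expr b x) u /\
  forall v, mdiff b x v =
    (v, v *m mdiff_mx (base_map b) x, 'd (bis_expr b x) u v).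
Proof.
move=> [oU sb bsrc dphi] Ux u.
have [_ _ sphi _] := dphi.
have dphiu : differentiable (loc_expr (base_map b) x) u.
  exact: smooth_at_differentiable (smooth_on_loc sphi Ux).
have [_ sH] := sb x Ux.
have dH : differentiable (loc_expr b x) u by exact: smooth_at_differentiable sH.
have HE : \forall u' \near u, loc_expr b x u' =
    (u', loc_expr (base_map b) x u', bis_expr b x u').
  have nU : \forall x' \near x, U x' by exact: open_nbhs_nbhs.
  apply: filterS (near_cinv (chart_at_atlas x) (chart_at_dom x) nU).
  move=> _ [x' [Ux' cx' ->]].
  by rewrite /bis_expr /iso_expr /loc_expr /= /B1_to (ctoK cx') !bsrc.
have sndc : continuous (snd : B1_model R n -> 'M[R]_n).
  by move=> ?; exact: cvg_snd.
have dB : differentiable (bis_expr b x) u.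
  apply: (@near_differentiable _ _ _ (snd \o loc_expr b x)).
    by apply: filterS HE => u' /(congr1 snd).
  apply: (differentiable_comp dH).
  exact: (@linear_differentiable _ (_ * _)%type _ snd).
split=> // v.
have HE' : {near u, (fun u' =>
    ((id u', loc_expr (base_map b) x u'), bis_expr b x u')) =1 loc_expr b x}.
  by apply: filterS HE => u' /esym.
have did : differentiable (id : 'rV[R]_n -> 'rV[R]_n) u by [].
have d1 := differentiable_pair did dphiu.
apply: etrans (near_diffE v HE' (differentiable_pair d1 dB)) _.
rewrite diff_pair//= diff_pair//= mulmx_jacobian.
by congr (_, _, _); exact: diff_idE.
Qed.

(** The condition p = p_* is stated for some bisection representing the jet,
    but both sides are components of the jet itself. *)
Lemma sh_rep j U b : B11_sh j -> jet_rep j U b ->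
  iso_mx (b (jet_src j)) = mdiff_mx (base_map b) (jet_src j).
Proof.
move=> [U' [b' [[lb' Ux' ej'] sh']]] [lb Ux ej].
have [_ mb'] := mdiff_bisection lb' Ux'; have [_ mb] := mdiff_bisection lb Ux.
have e1 : b' (jet_src j) = b (jet_src j).
  exact: (congr1 fst (etrans (esym ej') ej)).
have e2 : mdiff b' (jet_src j) = mdiff b (jet_src j).
  exact: (congr1 snd (etrans (esym ej') ej)).
rewrite -e1 sh'; apply: mulmx_inj => v.
have := congr1 (fun f => (f v).1.2) e2.
by move=> e3; rewrite mb mb' in e3.
Qed.

(** At a zero of Z the bracket no longer differentiates X. Here this is used
    for Z = Y + s_x Y, which vanishes at x since s_x acts there by - 1; it is
    why the connection is tensorial in X. *)
Lemma bracket_at_zero (X Z : M -> 'rV[R]_n) (x : M) :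
  field_expr (chart_at x) Z (cto (chart_at x) x) = 0 ->
  bracket X Z x = 'd (field_expr (chart_at x) Z) (cto (chart_at x) x) (X x).
Proof.
move=> Z0; exact: lie_bracket_at_zero (field_expr_id X x) Z0.
Qed.

Variable s : symmetry_jet M.

(** The Christoffel symbol of the connection in the preferred chart at x. *)
Definition Gamma (x : M) (v w : 'rV[R]_n) : 'rV[R]_n :=
  - (2^-1 *: (w *m ((s x).2 v).2)).

(** For Z = Y + s_x Y one has nabla_X Y = 1/2 DZ(X). As Ds_x^0 = - 1 and s_x(x)
    = - 1, [act_diff] in the direction - X gives D(s_x Y)(X) = DY(X) - Y
    Ds_x(X), where the sign of DY is changed twice. *)
Lemma conn_formula (X Y : M -> 'rV[R]_n) (x : M) :
  let u := cto (chart_at x) x in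
  differentiable (field_expr (chart_at x) Y) u ->
  conn s X Y x = 'd (field_expr (chart_at x) Y) u (X x) + Gamma x (X x) (Y x).
Proof.
move=> u dY.
have esx : jet_src (s x) = x by rewrite /jet_src sjet_minus_id.
have sjr : jet_rep (s x) (sjet_rep s x).1 (sjet_rep s x).2.
  exact: projT2 (cid (sjet_rep_ex s x)).
have shr := sh_rep (sjet_sh s x) sjr.
rewrite /conn; move: sjr shr.
set U := (sjet_rep s x).1; set b := (sjet_rep s x).2.
move=> [lb]; rewrite !esx => Ux ej shr.
have bx : b x = minus_id x by rewrite -(sjet_minus_id s) ej.
have phix : base_map b x = x by rewrite /base_map bx.
have [oU _ _ dphi0] := lb; have dphi : local_diffeo U (base_map b) := dphi0.
have [dB mb] := mdiff_bisection lb Ux.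
have Ax : iso_field b x = - 1%:M by rewrite /iso_field bx minus_id_mx.
have Jx : mdiff_mx (base_map b) x = - 1%:M.
  by rewrite -shr -[LHS]/(iso_field b x) Ax.
have := act_diff dphi oU (@subset_refl _ U) Ux dY dB.
have := act_eq (iso_field b) Y dphi (@subset_refl _ U) Ux.
rewrite -bis_actE phix Ax Jx => Zx [dZ dZE].
have sx v : ((s x).2 v).2 = 'd (bis_expr b x) u v by rewrite ej /= mb.
(* - X is the vector that the differential - 1 of s_x^0 maps to X. *)
have dZX : 'd (field_expr (chart_at x) (bis_act U b Y)) u (X x) =
  'd (field_expr (chart_at x) Y) u (X x) - Y x *m ((s x).2 (X x)).2.
  have mN (v : 'rV[R]_n) : v *m - 1%:M = - v by rewrite mulmxN mulmx1.
  have XN : X x = (- X x) *m - 1%:M by rewrite mN opprK.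
  rewrite [in LHS]XN; apply: etrans (dZE _) _; congr (_ + _).
    by rewrite mN -[RHS]opprK; congr (- _); exact: linearN.
  by rewrite -mulmxN sx; congr (_ *m _); exact: linearN.
pose Z : M -> 'rV[R]_n := fun y => Y y + bis_act U b Y y.
rewrite -/Z; have Ze : field_expr (chart_at x) Z =
    field_expr (chart_at x) Y + field_expr (chart_at x) (bis_act U b Y).
  by apply/funext => w; rewrite /field_expr mulmxDl.
have Z0 : field_expr (chart_at x) Z u = 0.
  by apply: etrans (field_expr_id Z x) _; rewrite /Z Zx mulmxN mulmx1 subrr.
rewrite (bracket_at_zero _ Z0).
have dZs : 'd (field_expr (chart_at x) Z) u (X x) =
    'd (field_expr (chart_at x) Y) u (X x) +
    'd (field_expr (chart_at x) (bis_act U b Y)) u (X x).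
  by rewrite Ze; exact: diffDE.
apply: etrans (congr1 _ (etrans dZs (congr1 _ dZX))) _.
exact: half_double.
Qed.

End connection.

(** * Affinity as an identity between Christoffel symbols *)

Section chart_change.
Variables (R : realType) (n : nat) (M : manifold R n).
Implicit Types (c d : chart 'rV[R]_n M).

(** The matrix of phi in arbitrary charts c and d. Since it holds for every x'
    near x with c and d fixed, it identifies the expression of the field of
    differentials of phi with the Jacobian of the expression of phi. *)
Lemma jacobian_chart_change (phi : M -> M) (x : M) c d :
  atlas c -> atlas d -> cdom c x -> cdom d (phi x) ->
  {for x, continuous phi} ->
  differentiable (loc_expr phi x) (cto (chart_at x) x) ->
  'J (cto d \o phi \o cinv c) (cto c x) =
  tan_from_mx c x *m mdiff_mx phi x *m tan_to_mx d (phi x).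
Proof.
move=> ac ad cx dx phic dphi.
have ae := chart_at_atlas x; have ex := chart_at_dom x.
have af := chart_at_atlas (phi x); have fx := chart_at_dom (phi x).
set e := chart_at x in ae ex dphi *; set f := chart_at (phi x) in af fx *.
pose A := cto e \o cinv c; pose C := cto d \o cinv f.
have dA : differentiable A (cto c x) by exact: cto_diff.
have Ax : A (cto c x) = cto e x by rewrite /A /= ctoK.
have Bx : loc_expr phi x (cto e x) = cto f (phi x).
  by rewrite /loc_expr /= -/e -/f ctoK.
have dB : differentiable (loc_expr phi x) (A (cto c x)) by rewrite Ax.
have dC : differentiable C (loc_expr phi x (A (cto c x))).
  by rewrite Ax Bx; exact: cto_diff.
have near_x : \forall x' \near x, cdom e x' /\ cdom f (phi x').
  apply: filterI; first exact: cdom_near.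
  by apply: phic; exact: cdom_near.
have E : {near cto c x,
    C \o (loc_expr phi x \o A) =1 cto d \o phi \o cinv c}.
  apply: filterS (near_cinv ac cx near_x) => _ [x' [[ex' fx'] cx' ->]].
  by rewrite /C /A /loc_expr /= -/e -/f (ctoK cx') (ctoK ex') (ctoK fx').
have dBA := differentiable_comp dA dB.
apply: etrans (near_jacobian E (differentiable_comp dBA dC)) _.
apply: etrans (jacobian_comp dBA dC) _.
apply: etrans (congr1 (mulmx^~ _) (jacobian_comp dA dB)) _.
have -> : (loc_expr phi x \o A) (cto c x) = cto f (phi x) by rewrite /= Ax Bx.
by rewrite Ax.
Qed.

Lemma jacobian_transition c d (x : M) :
  atlas c -> atlas d -> cdom c x -> cdom d x ->
  'J (cto d \o cinv c) (cto c x) = tan_from_mx c x *m tan_to_mx d x.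
Proof.
move=> ac ad cx dx.
have idc : {for x, continuous (idfun : M -> M)} by exact: cvg_id.
have [didx id1] := jacobian_id
  (near_chart_id (chart_at_atlas x) (chart_at_dom x)).
have := @jacobian_chart_change idfun x c d ac ad cx dx idc didx.
have -> : mdiff_mx idfun x = 1%:M by exact: id1.
by rewrite mulmx1.
Qed.

(** Constant coefficients in the chart c; these fields realize every pair of
    vectors at a point when affinity is tested. *)
Definition const_field c (v : 'rV[R]_n) (x : M) : 'rV[R]_n :=
  v *m tan_from_mx c x.

Lemma const_field_smooth c v :
  atlas c -> smooth_field (cdom c) (const_field c v).
Proof.
move=> ac y cy; have ad := chart_at_atlas y; have dy := chart_at_dom y.
set d := chart_at y in ad dy *.
have sT := transition_smooth_at ac ad cy dy.
have sT' := transition_smooth_at ad ac dy cy.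
have sTv : smooth_at (fun u => 'd (cto d \o cinv c) u v)
    ((cto c \o cinv d) (cto d y)).
  by rewrite /= (ctoK dy); exact: smooth_at_diff.
apply: smooth_at_eq (smooth_at_comp sT' sTv).
have cyn : \forall y' \near y, cdom c y' by exact: cdom_near.
apply: filterS (near_cinv ad dy cyn) => _ [y' [cy' dy' ->]].
rewrite /field_expr /const_field /= (ctoK dy') -mulmx_jacobian.
by rewrite (jacobian_transition ac ad cy' dy') mulmxA.
Qed.

Lemma const_field_id (x : M) v : const_field (chart_at x) v x = v.
Proof. by rewrite /const_field tan_from_mx_id mulmx1. Qed.

Lemma smooth_field_subset (W W' : set M) (X : M -> 'rV[R]_n) :
  W' `<=` W -> smooth_field W X -> smooth_field W' X.
Proof. by move=> W'W sX x /W'W /sX. Qed.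

Lemma smooth_field_differentiable (W : set M) (X : M -> 'rV[R]_n) x :
  smooth_field W X -> W x ->
  differentiable (field_expr (chart_at x) X) (cto (chart_at x) x).
Proof. by move=> sX /sX; exact: smooth_at_differentiable. Qed.

End chart_change.

Section affinity.
Variables (R : realType) (n : nat) (M : manifold R n) (s : symmetry_jet M).

(** A and L stand for the value and the derivative of a field of isomorphisms
    at x: the transformation law of Christoffel symbols. *)
Definition preserves_christoffel (x y : M) (A : 'M[R]_n)
    (L : 'rV[R]_n -> 'M[R]_n) : Prop :=
  forall v w : 'rV[R]_n,
    w *m L v + Gamma s y (v *m A) (w *m A) = Gamma s x v w *m A.

(** Both sides contain DY(X) B, on the right by [act_diff] at the vector X,
    whose image by the differential of phi is X B. It cancels, and what is left
    depends on the values of the fields at x only. *)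
Lemma conn_act_eq (U W : set M) (phi : M -> M) (B : M -> 'M[R]_n)
    (X Y X' : M -> 'rV[R]_n) (x : M) :
  local_diffeo U phi -> open W -> W `<=` U -> W x ->
  B x = mdiff_mx phi x ->
  differentiable (iso_expr phi B x) (cto (chart_at x) x) ->
  differentiable (field_expr (chart_at x) Y) (cto (chart_at x) x) ->
  X' (phi x) = X x *m B x ->
  conn s X Y x *m B x = conn s X' (act W phi B Y) (phi x) <->
  Y x *m 'd (iso_expr phi B x) (cto (chart_at x) x) (X x) +
    Gamma s (phi x) (X x *m B x) (Y x *m B x) = Gamma s x (X x) (Y x) *m B x.
Proof.
move=> dphi oW WU Wx BE dB dY X'E.
have [dZ dZE] := act_diff dphi oW WU Wx dY dB.
have e1 := conn_formula s X dY.
have e2 := conn_formula s X' dZ.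
have Zx := act_eq B Y dphi WU Wx.
have e3 := dZE (X x).
rewrite -BE -X'E in e3.
have e4 := etrans (congr1 (mulmx^~ (B x)) e1) (mulmxDl _ _ _).
have e5 := etrans e2 (congr2 +%R e3 (congr2 (Gamma s (phi x)) X'E Zx)).
rewrite e4 e5; exact: addr_cancel_iff.
Qed.

Lemma affine_at_compat U b x : local_bisection U b -> U x ->
  iso_field b x = mdiff_mx (base_map b) x ->
  affine_at s U b x <-> preserves_christoffel x (base_map b x) (iso_field b x)
                          ('d (bis_expr b x) (cto (chart_at x) x)).
Proof.
move=> lb Ux sh; have [oU _ _ dphi0] := lb.
have dphi : local_diffeo U (base_map b) := dphi0.
have [dB _] := mdiff_bisection lb Ux.
split=> [aff v w|compat W W' X X' Y oW Wx WU oW' W'y sX sY sX' X'E]; last first.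
  have dY := smooth_field_differentiable sY Wx.
  exact: (proj2 (conn_act_eq dphi oW WU Wx sh dB dY X'E)).
pose c := chart_at x; have ac := chart_at_atlas x; have cx := chart_at_dom x.
pose y := base_map b x.
pose d := chart_at y; have ad := chart_at_atlas y; have dy := chart_at_dom y.
have oW : open (U `&` cdom c) by apply: openI => //; exact: cdom_open.
have Wx : (U `&` cdom c) x by [].
have WU : U `&` cdom c `<=` U by move=> z [].
have Wc : U `&` cdom c `<=` cdom c by move=> z [].
have sF v' := smooth_field_subset Wc (const_field_smooth v' ac).
have X'E : const_field d (v *m iso_field b x) y =
    const_field c v x *m iso_field b x by rewrite !const_field_id.
have := aff _ (cdom d) _ _ _ oW Wx WU (cdom_open ad) dy (sF v) (sF w)
  (const_field_smooth (v *m iso_field b x) ad) X'E.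
have dY := smooth_field_differentiable (sF w) Wx.
move=> /(proj1 (conn_act_eq dphi oW WU Wx sh dB dY X'E)).
by rewrite !const_field_id.
Qed.

(** The pushforward is the action of the differential of phi, which agrees with
    b on U; the expressions of the two fields therefore have the same germ,
    hence the same derivative. *)
Lemma affine_on_compat U b : local_bisection U b ->
  (forall x, U x -> iso_field b x = mdiff_mx (base_map b) x) ->
  affine_on s U (base_map b) <-> forall x, U x ->
    preserves_christoffel x (base_map b x) (iso_field b x)
                          ('d (bis_expr b x) (cto (chart_at x) x)).
Proof.
move=> lb sh; have [oU _ _ dphi0] := lb.
have dphi : local_diffeo U (base_map b) := dphi0.
pose J := mdiff_mx (base_map b).
have JE x : U x -> {near cto (chart_at x) x,
    bis_expr b x =1 iso_expr (base_map b) J x}.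
  move=> Ux; have nU : \forall x' \near x, U x' by exact: open_nbhs_nbhs.
  apply: filterS (near_cinv (chart_at_atlas x) (chart_at_dom x) nU).
  move=> _ [x' [Ux' cx' ->]].
  by rewrite /bis_expr /iso_expr /= (ctoK cx') sh.
have dB x (Ux : U x) := proj1 (mdiff_bisection lb Ux).
have dJ x (Ux : U x) := near_differentiable (JE x Ux) (dB x Ux).
have dJE x (Ux : U x) v := near_diffE v (JE x Ux) (dB x Ux).
split=> [aff x Ux v w|compat W X Y oW WU sX sY x Wx]; last first.
  have Ux := WU _ Wx; have dY := smooth_field_differentiable sY Wx.
  have X'E := act_eq J X dphi WU Wx.
  apply: (proj2 (conn_act_eq dphi oW WU Wx erefl (dJ x Ux) dY X'E)).
  have := compat x Ux (X x) (Y x); rewrite (sh x Ux) => <-.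
  exact: (congr1 (fun L => Y x *m L + _) (dJE x Ux (X x))).
pose c := chart_at x; have ac := chart_at_atlas x; have cx := chart_at_dom x.
have oW : open (U `&` cdom c) by apply: openI => //; exact: cdom_open.
have Wx : (U `&` cdom c) x by [].
have WU : U `&` cdom c `<=` U by move=> z [].
have Wc : U `&` cdom c `<=` cdom c by move=> z [].
have sF v' := smooth_field_subset Wc (const_field_smooth v' ac).
have X'E := act_eq J (const_field c v) dphi WU Wx.
have := aff _ _ _ oW WU (sF v) (sF w) x Wx.
have dY := smooth_field_differentiable (sF w) Wx.
move=> /(proj1 (conn_act_eq dphi oW WU Wx erefl (dJ x Ux) dY X'E)).
rewrite !const_field_id (sh x Ux) => <-.
exact: (congr1 (fun L => w *m L + _) (esym (dJE x Ux v))).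
Qed.

End affinity.

(** * Bisections and the tangent spaces of their images *)

Section extension.
Variables (R : realType) (n : nat) (M : manifold R n).

Lemma iso_field_j1 (U : set M) phi x : local_diffeo U phi -> U x ->
  iso_field (j1 phi) x = mdiff_mx phi x.
Proof.
move=> dphi Ux; rewrite /iso_field /= unit_or_1E//.
exact: mdiff_mx_unit dphi Ux.
Qed.

(** In the charts fixed at x and phi x, the map j1 phi is u |-> (u, F u, 'J F
    u) with F the expression of phi, so it is smooth. Its continuity is then
    read in the same charts. *)
Lemma j1_local_bisection (U : set M) phi :
  local_diffeo U phi -> local_bisection U (j1 phi).
Proof.
move=> dphi; have [oU _ sphi _] := dphi; split=> // x Ux.
pose c := chart_at x; have ac := chart_at_atlas x; have cx := chart_at_dom x.
pose d := chart_at (phi x); have ad := chart_at_atlas (phi x).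
have dphix := near_chart_image sphi Ux.
have nUd : \forall x' \near x, U x' /\ cdom d (phi x').
  by apply: filterI => //; exact: open_nbhs_nbhs.
have sF := smooth_on_loc sphi Ux; set F := loc_expr phi x in sF.
have HE : {near cto c x,
    (fun u => (u, F u, 'J F u)) =1 loc_expr (j1 phi : M -> B1 M) x}.
  apply: filterS (near_cinv ac cx nUd) => _ [x' [[Ux' dx'] cx' ->]].
  have JF := jacobian_chart_change ac ad cx' dx' (smooth_on_continuous sphi Ux')
    (smooth_at_differentiable (smooth_on_loc sphi Ux')).
  rewrite JF /F /loc_expr /= /B1_to /= (ctoK cx') unit_or_1E//.
  exact: mdiff_mx_unit dphi Ux'.
have sH : smooth_at (loc_expr (j1 phi : M -> B1 M) x) (cto c x).
  apply: smooth_at_eq HE _; apply: smooth_at_pair (smooth_at_jacobian sF).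
  exact: smooth_at_pair (smooth_at_id _) sF.
split=> //.
have aC := chart_at_atlas (j1 phi x : B1 M).
apply: (@chart_continuous _ _ (B1 M) _ (j1 phi : M -> B1 M) x _ aC).
  by apply: filterI => //; exact: cdom_near.
have Hc : {for x, continuous (loc_expr (j1 phi : M -> B1 M) x \o cto c)}.
  apply: continuous_comp; first exact: cto_continuous.
  exact/differentiable_continuous/smooth_at_differentiable.
apply: near_continuous Hc.
have ncx : \forall x' \near x, cdom c x' by exact: cdom_near.
by apply: filterS ncx => x' cx'; rewrite /loc_expr /= (ctoK cx').
Qed.

Section bisection_image.
Variables (U : set M) (b : M -> B1 M).
Hypothesis lb : local_bisection U b.

Lemma src_bisection x : U x -> src (b x) = x.
Proof. by have [_ _ + _] := lb; apply. Qed.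

Lemma image_bisection_src xi : (b @` U) xi -> U (src xi) /\ xi = b (src xi).
Proof. by move=> [x Ux <-]; rewrite src_bisection. Qed.

Lemma bisection_smooth_chart (c : chart 'rV[R]_n M) x : atlas c -> cdom c x ->
  U x -> {for cto c x, continuous (b \o cinv c)} /\
    {near cto c x, loc_expr b x \o (cto (chart_at x) \o cinv c) =1
       cto (chart_at (b x)) \o (b \o cinv c)}.
Proof.
move=> ac cx Ux; have [_ sb _ _] := lb; have [bc _] := sb x Ux.
split.
  apply: continuous_comp; first exact: cinv_continuous.
  by rewrite ctoK.
have ncx : \forall x' \near x, cdom (chart_at x) x'.
  by apply: cdom_near; [exact: chart_at_atlas|exact: chart_at_dom].
apply: filterS (near_cinv ac cx ncx) => _ [x' [ex' cx' ->]].
by rewrite /loc_expr /= (ctoK cx') (ctoK ex').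
Qed.

(** The charts c and chart_at x may differ: this is the chain rule for the
    transition between them. *)
Lemma pdiff_bisection (c : chart 'rV[R]_n M) x v : atlas c -> cdom c x -> U x ->
  pdiff (b \o cinv c : 'rV[R]_n -> B1 M) (cto c x) v =
  mdiff b x (v *m tan_from_mx c x).
Proof.
move=> ac cx Ux; have [_ E] := bisection_smooth_chart ac cx Ux.
have [_ sb _ _] := lb; have [_ sH] := sb x Ux.
have dT : differentiable (cto (chart_at x) \o cinv c) (cto c x).
  by apply: cto_diff => //; [exact: chart_at_atlas|exact: chart_at_dom].
have dH :
    differentiable (loc_expr b x) ((cto (chart_at x) \o cinv c) (cto c x)).
  by rewrite /= ctoK//; exact: smooth_at_differentiable sH.
rewrite /pdiff; have -> : (b \o cinv c) (cto c x) = b x by rewrite /= ctoK.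
apply: etrans (near_diffE v E (differentiable_comp dT dH)) _.
apply: etrans (diff_compE v dT dH) _.
rewrite /mdiff /tan_from_mx mulmx_jacobian.
suff -> : (cto (chart_at x) \o cinv c) (cto c x) = cto (chart_at x) x by [].
by rewrite /= ctoK.
Qed.

Lemma mdiff_bisection_inj x : U x -> injective (mdiff b x).
Proof.
move=> Ux v v' e; have [_ mb] := mdiff_bisection lb Ux.
by have := congr1 (fun w => w.1.1) e; rewrite !mb.
Qed.

Lemma bisection_local_param x : U x ->
  let c := chart_at x in
  local_param (b @` U) (src (M := M) @^-1` (U `&` cdom c))
    (cto c @` (U `&` cdom c)) (b \o cinv c).
Proof.
move=> Ux c; have ac := chart_at_atlas x; have [oU sb _ _] := lb.
have oUc : open (U `&` cdom c) by apply: openI => //; exact: cdom_open.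
split.
- by apply: open_comp oUc => xi _; exact: src_continuous.
- exact: cto_open.
- move=> _ [x' [Ux' cx'] <-]; have [fc E] := bisection_smooth_chart ac cx' Ux'.
  split=> //; rewrite -/(smooth_at _ _).
  have -> : (b \o cinv c) (cto c x') = b x' by rewrite /= ctoK.
  apply: smooth_at_eq E _; apply: smooth_at_comp.
    apply: transition_smooth_at => //; first exact: chart_at_atlas.
    exact: chart_at_dom.
  by rewrite /= ctoK//; have [_] := sb x' Ux'.
- move=> _ [x' [Ux' cx'] <-] v v'; rewrite !pdiff_bisection//.
  move=> /(mdiff_bisection_inj Ux')/(congr1 (mulmx^~ (tan_to_mx c x'))).
  by rewrite -!mulmxA tan_from_toK// !mulmx1.
- split.
    apply/seteqP; split=> [_ [_ [x' [Ux' cx'] <-] <-]|xi [Nxi [Uxi cxi]]].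
      by rewrite /= (ctoK cx') (src_bisection Ux'); split=> //; exists x'.
    exists (cto c (src xi)); first by exists (src xi).
    by rewrite /= ctoK//; have [_ <-] := image_bisection_src Nxi.
  exists (cto c \o src (M := M)); split.
    apply: continuous_in_subspaceT => xi /[!inE] -[_ [_ cxi]].
    apply: continuous_comp; first exact: src_continuous.
    exact: cto_continuous.
  by move=> _ [x' [Ux' cx'] <-]; rewrite /= (ctoK cx') src_bisection.
Qed.

Lemma bisection_submanifold : submanifold n (b @` U).
Proof.
move=> _ [x Ux <-]; do 3 eexists; split.
  exact: (bisection_local_param Ux).
by rewrite /= src_bisection//; split => //; exact: chart_at_dom.
Qed.

(** Any local parametrization f of the image factors as f = b o p with p = src
    o f, so its differential takes values in the range of that of b; the
    parametrization b o cinv (chart_at x) attains the whole range. *)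
Lemma bisection_tangent_space x : U x ->
  tangent_space n (b @` U) (b x) = range (mdiff b x).
Proof.
move=> Ux; pose c := chart_at x.
have ac := chart_at_atlas x; have cx := chart_at_dom x.
apply/seteqP; split; last first.
  move=> _ [v _ <-].
  do 3 eexists; exists (cto c x); split.
  - exact: (bisection_local_param Ux).
  - by exists x.
  - by rewrite /= ctoK.
  - exists v; [exact: I|apply: etrans (pdiff_bisection v ac cx Ux) _].
    by rewrite tan_from_mx_id mulmx1.
move=> _ [W [V [f [u [[oW oV sf _ [fVN _]] Vu fu [v _ <-]]]]]].
have [fc sfu] := sf u Vu.
have srcu : src (f u) = x by rewrite fu src_bisection.
pose p : 'rV[R]_n -> M := src (M := M) \o f.
have pc : {for u, continuous p}.
  by apply: continuous_comp => //; exact: src_continuous.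
have nb : \forall u' \near u, [/\ f u' = b (p u'), U (p u') & cdom c (p u')].
  have nV : \forall u' \near u, V u' by exact: open_nbhs_nbhs.
  have nc : \forall u' \near u, cdom c (p u').
    by apply: pc; rewrite /p /= srcu; exact: cdom_near.
  apply: filterS2 nV nc => u' Vu' cpu'.
  have Nu' : (b @` U) (f u').
    have : (f @` V) (f u') by exists u'.
    by rewrite fVN => -[].
  by have [Upu' ?] := image_bisection_src Nu'; split.
have [_ sb _ _] := lb; have [_ sH] := sb x Ux.
have dC : differentiable (cto (chart_at (f u)) \o f) u.
  exact: smooth_at_differentiable sfu.
have dh : differentiable (cto c \o p) u.
  have -> : cto c \o p = (fst \o fst) \o (cto (chart_at (f u)) \o f).
    by apply/funext => u'; rewrite /= /B1_to /= srcu.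
  apply: differentiable_comp dC _.
  apply: differentiable_comp;
  by apply: (@linear_differentiable _ (_ * _)%type _ fst) => w; exact: cvg_fst.
have hu : (cto c \o p) u = cto c x by rewrite /p /= srcu.
have dH : differentiable (loc_expr b x) ((cto c \o p) u).
  by rewrite hu; exact: smooth_at_differentiable sH.
exists ('d (cto c \o p) u v); first exact: I.
have E : {near u, loc_expr b x \o (cto c \o p) =1 cto (chart_at (f u)) \o f}.
  apply: filterS nb => u' [fu' _ cpu'].
  by rewrite /loc_expr /= (ctoK cpu') -fu' fu.
have e1 := near_diffE v E (differentiable_comp dh dH).
have e2 := etrans e1 (diff_compE v dh dH).
rewrite hu in e2; exact: (esym e2).
Qed.

End bisection_image.
End extension.

(** * Leaves *)

Section leaves.
Variables (R : realType) (n : nat) (M : manifold R n) (s : symmetry_jet M).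

Lemma preserves_christoffel_unique x y (A : 'M[R]_n)
    (L L' : 'rV[R]_n -> 'M[R]_n) v :
  preserves_christoffel s x y A L -> preserves_christoffel s x y A L' ->
  L v = L' v.
Proof.
move=> cL cL'; apply: mulmx_inj => w.
by apply: (addIr (Gamma s y (v *m A) (w *m A))); rewrite cL cL'.
Qed.

(** The first component of any affine extension of xi is forced by the source
    map, the second by p = p_* and the third by [preserves_christoffel]. *)
Lemma affine_extension_jet xi j : affine_extension s xi j ->
  exists2 L, preserves_christoffel s (src xi) (tgt xi) (iso_mx xi) L &
    forall U a, jet_rep j U a -> forall v,
      mdiff a (src xi) v = (v, v *m iso_mx xi, L v).
Proof.
move=> [shj j1xi [U [a [rep aff]]]].
have ejx : jet_src j = src xi by rewrite /jet_src j1xi.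
have := sh_rep shj rep; rewrite ejx => sh.
have [la Ua ja] := rep; rewrite ejx in Ua ja.
have axi : a (src xi) = xi by rewrite -[RHS]j1xi ja.
have := proj1 (affine_at_compat s la Ua sh) aff.
rewrite /base_map /iso_field axi => cL.
exists ('d (bis_expr a (src xi)) (cto (chart_at (src xi)) (src xi))) => //.
move=> U' a' [_ _]; rewrite ejx => ja' v.
have -> : mdiff a' (src xi) v = mdiff a (src xi) v.
  exact: (congr1 (fun j : jet M => j.2 v) (etrans (esym ja') ja)).
have [_ ->] := mdiff_bisection la Ua.
by rewrite -sh axi.
Qed.

Variables (U : set M) (b : M -> B1 M).
Hypothesis lb : local_bisection U b.

Lemma leaf_of_affine :
  (forall x, U x -> iso_field b x = mdiff_mx (base_map b) x) ->
  affine_on s U (base_map b) -> leaf s (b @` U).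
Proof.
move=> sh /(affine_on_compat s lb sh) compat.
split=> [|_ [x Ux <-]]; first exact: bisection_submanifold lb.
rewrite (bisection_tangent_space lb Ux).
have srcx := src_bisection lb Ux.
pose j : jet M := (b x, mdiff b x).
have ejx : jet_src j = x by exact: srcx.
have rep : jet_rep j U b by split; rewrite ?ejx.
have affx : affine_extension s (b x) j.
  split; [|by []|].
    by exists U, b; split; [exact: rep|rewrite ejx; exact: sh].
  exists U, b; split; [exact: rep|rewrite srcx].
  exact: (proj2 (affine_at_compat s lb Ux (sh x Ux)) (compat x Ux)).
apply/seteqP; split=> w.
  move=> [v _ <-]; exists j, U, b; split; [exact: affx|exact: rep|].
  by exists v; [exact: I|rewrite srcx].
move=> [j' [U' [a [aff ra [v _ <-]]]]]; exists v; first exact: I.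
have [L cL La] := affine_extension_jet aff.
have [L' cL' Lb] := affine_extension_jet affx.
have eL := preserves_christoffel_unique v cL' cL.
have := Lb U b rep v; rewrite eL -(La U' a ra) => <-.
by rewrite srcx.
Qed.

(** The extension provided by the distribution may vary with v, but the
    components of a single tangent vector suffice: the identities to prove
    involve one v at a time. *)
Lemma affine_of_leaf : leaf s (b @` U) ->
  (forall x, U x -> iso_field b x = mdiff_mx (base_map b) x) /\
  affine_on s U (base_map b).
Proof.
move=> [_ tanN].
have ext x : U x -> forall v, exists2 L,
    preserves_christoffel s x (base_map b x) (iso_field b x) L &
    mdiff b x v = (v, v *m iso_field b x, L v).
  move=> Ux v; have srcx := src_bisection lb Ux.
  have : distr s (b x) (mdiff b x v).
    rewrite -tanN; last by exists x.
    by rewrite (bisection_tangent_space lb Ux); exists v.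
  move=> [j [U' [a [aff ra [v' _ E]]]]].
  have [L cL La] := affine_extension_jet aff.
  have E' := etrans (esym (La U' a ra v')) E.
  have [_ mb] := mdiff_bisection lb Ux.
  (* Both vectors are graphs over their first component. *)
  have vv' : v' = v.
    by have := congr1 (fun w => w.1.1) E'; rewrite mb.
  by exists L; [rewrite srcx in cL|rewrite -E' vv'].
have sh x : U x -> iso_field b x = mdiff_mx (base_map b) x.
  move=> Ux; apply: mulmx_inj => v; have [L _ E] := ext x Ux v.
  have [_ mb] := mdiff_bisection lb Ux.
  exact: (congr1 (fun w => w.1.2) (etrans (esym E) (mb v))).
split=> //; apply/(affine_on_compat s lb sh) => x Ux v w.
have [L cL E] := ext x Ux v; have [_ mb] := mdiff_bisection lb Ux.
have -> : 'd (bis_expr b x) (cto (chart_at x) x) v = L v.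
  exact: (congr1 snd (etrans (esym (mb v)) E)).
exact: cL.
Qed.

Lemma j1_base_map x : U x -> iso_field b x = mdiff_mx (base_map b) x ->
  j1 (base_map b) x = b x.
Proof.
move=> Ux sh; apply: lin_iso_eq; first by rewrite (src_bisection lb Ux).
  by [].
by rewrite /= -sh unit_or_1E//; exact: iso_mxP.
Qed.

End leaves.

Theorem proposition3p8 (R : realType) (n : nat) (M : manifold R n)
    (s : symmetry_jet M) :
  (forall U : set M, open U ->
     bij_on_dom U
       [set phi : M -> M | local_diffeo U phi /\ affine_on s U phi]
       [set b : M -> B1 M | local_bisection U b /\ leaf s (b @` U)]
       (@j1 R n M)) /\
  set_bij
    [set phi : M -> M | diffeo phi /\ affine_on s setT phi]
    [set b : M -> B1 M | bisection b /\ leaf s (range b)]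
    (@j1 R n M).
Proof.
have j1_leaf (U : set M) phi : local_diffeo U phi -> affine_on s U phi ->
    local_bisection U (j1 phi) /\ leaf s ((j1 phi : M -> B1 M) @` U).
  move=> dphi aff; have lb := j1_local_bisection dphi; split=> //.
  by apply: (leaf_of_affine lb) => // x Ux; exact: iso_field_j1 dphi Ux.
have leaf_j1 (U : set M) (b : M -> B1 M) :
    local_bisection U b -> leaf s (b @` U) ->
    [/\ local_diffeo U (base_map b), affine_on s U (base_map b) &
        forall x, U x -> j1 (base_map b) x = b x].
  move=> lb /(affine_of_leaf lb)[sh aff]; have [_ _ _ dphi] := lb.
  by split=> // x Ux; apply: (j1_base_map lb Ux); exact: sh.
split=> [U _|].
  split=> [phi [dphi aff]|phi phi' _ _ E x /E|b [lb lf]].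
  - exact: j1_leaf.
  - by move=> /(congr1 (@tgt _ _ _)).
  - by have [dphi aff E] := leaf_j1 U b lb lf; exists (base_map b).
split=> [phi [dphi aff]|phi phi' _ _ E|b [[lb db] lf]].
- have [lb lf] := j1_leaf setT phi (proj1 dphi) aff.
  by split.
- by apply/funext => x; have /(congr1 (@tgt _ _ _)) := congr1 (@^~ x) E.
- have [dphi aff E] := leaf_j1 setT b lb lf.
  by exists (base_map b) => //; apply/funext => x; exact: E.
Qed.
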